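(* In the partial order of $\Sigma^0_2$ enumeration degrees (all variables below range over $\Sigma^0_2$ sets), the following statements hold. (1) For all $A_0,B_0,A_1,B_1$ there exists $Z$ such that: if $B_0\le_e A_1$, $A_0\not\le_e B_0$ and $A_1\not\le_e B_1$, then either ($Z<_e A_0$ and $Z\not\le_e B_0$) or ($Z<_e A_1$ and $Z\not\le_e B_1$). (2) For all natural numbers $n,m$ and all $\hat A,A,B_0,\dots,B_n,C_0,\dots,C_m$ there exists $Z$ such that: if $\hat A\le_e A$, $\hat A\le_e B_0$, $\hat A\not\le_e B_i$ for all $i\ne0$, and $A,B_0,\dots,B_n,C_0,\dots,C_m$ are pairwise $\le_e$-incomparable, then either ($Z<_e A$ and $Z\not\le_e B_i$ for every $i\le n$) or ($Z<_e B_0$ and $Z\not\le_e C_i$ for every $i\le m$). (3) For all $A,B,C,D_0,D_1$ there exists $Z$ such that: if $A,B,C$ are pairwise $\le_e$-incomparable, $D_0<_e A$, $D_0<_e B$, $D_1<_e B$ and $D_1<_e C$, then either ($D_0<_e Z<_e A$ and $Z\not\le_e B$) or ($D_1<_e Z<_e B$ and $Z\not\le_e C$).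
   Context: $\le_e$ is enumeration reducibility: $A\le_e B$ iff $A=\Gamma(B):=\{x:\exists\text{ finite }D\subseteq B,\ \langle x,D\rangle\in\Gamma\}$ for some c.e. set $\Gamma$; $<_e$ as usual. $\Sigma^0_2$ sets are exactly the sets $\le_e 0'_e$, the enumeration jump of $\emptyset$. *)

(* Defs.v *)
From Stdlib Require Import Arith List.
From Stdlib Require Cantor.
Import ListNotations.

Definition nset := nat -> Prop.

(** Partial recursive functions, as Kleene's mu-recursive functions in unary
    form: tuples of arguments are coded by the Cantor pairing bijection. *)
Inductive code : Type :=
| Zero : code
| Succ : code
| Left : code
| Right : code
| Pair : code -> code -> code
| Comp : code -> code -> code
| Prec : code -> code -> code
| Mu : code -> code.

(** [eval c x y]: the partial function coded by [c] is defined at [x], with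
    value [y].  [Prec f g] is h with h<a,0> = f a and
    h<a,n+1> = g<a,<n,h<a,n>>>; [Mu f] maps a to the least n with f<a,n> = 0,
    f<a,m> being defined and nonzero for every m < n. *)
Fixpoint eval (c : code) (x y : nat) {struct c} : Prop :=
  match c with
  | Zero => y = 0
  | Succ => y = S x
  | Left => y = fst (Cantor.of_nat x)
  | Right => y = snd (Cantor.of_nat x)
  | Pair f g =>
      exists a b, eval f x a /\ eval g x b /\ y = Cantor.to_nat (a, b)
  | Comp f g => exists z, eval g x z /\ eval f z y
  | Prec f g =>
      let (a, n) := Cantor.of_nat x in
      nat_rect (fun _ => nat -> Prop)
        (fun s => eval f a s)
        (fun m h s =>
           exists r, h r /\ eval g (Cantor.to_nat (a, Cantor.to_nat (m, r))) s)
        n y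
  | Mu f =>
      eval f (Cantor.to_nat (x, y)) 0 /\
      forall m, m < y -> exists k, eval f (Cantor.to_nat (x, m)) (S k)
  end.

Definition ce (W : nset) : Prop :=
  exists c, forall x, W x <-> exists y, eval c x y.

Definition computable (R : nset) : Prop :=
  exists c, forall x, (R x /\ eval c x 1) \/ (~ R x /\ eval c x 0).

Definition Sigma02 (A : nset) : Prop :=
  exists R : nset, computable R /\
    forall x, A x <->
      exists a, forall b, R (Cantor.to_nat (x, Cantor.to_nat (a, b))).

(** Finite sets are given by canonical (strong) indices: [u] codes the set of
    the positions of the binary digits 1 of [u]. *)
Definition fin_set (u : nat) : nset := fun i => Nat.testbit u i = true.

Definition enum_op (G B : nset) : nset := fun x =>
  exists u, (forall i, fin_set u i -> B i) /\ G (Cantor.to_nat (x, u)).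

Definition e_le (A B : nset) : Prop :=
  exists G, ce G /\ forall x, A x <-> enum_op G B x.

Notation "A ≤ₑ B" := (e_le A B) (at level 70, no associativity).

Definition e_lt (A B : nset) : Prop := A ≤ₑ B /\ ~ B ≤ₑ A.

Notation "A <ₑ B" := (e_lt A B) (at level 70, no associativity).

Definition e_incomparable (A B : nset) : Prop := ~ A ≤ₑ B /\ ~ B ≤ₑ A.

Definition pairwise_incomparable (l : list nset) : Prop :=
  ForallOrdPairs e_incomparable l.

(** The list F 0, ..., F n; it has n + 1 entries. *)
Definition upto (F : nat -> nset) (n : nat) : list nset :=
  map F (seq 0 (S n)).

(* Main.v *)
Require Import Defs.
From Stdlib Require Import Arith List Lia Classical.
From Stdlib Require Cantor.
Import ListNotations.

(** If every [Z] with [D ≤ₑ Z <ₑ A] satisfies [Z ≤ₑ B], although [D ≤ₑ A, B] and [A ≰ₑ B], call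
    [(A, B)] an Ahmad pair above [D].  Each of the three claims reduces to the fact that [(A0, B0)]
    and [(A1, B1)] cannot both be such pairs when [B0 ≤ₑ A1].

    For [X ≤ₑ A], a Gutteridge-style construction yields, uniformly in [e], a set [Z_e] between
    [D] and [A] that computes [A] iff [∃ k ∀ b, X(e, k, b)]: column [k] of [Z_e] codes [A] as long as
    [X(e, k, 0), X(e, k, 1), ...] hold, and a finite part of it is dumped in order to diagonalize.
    For the pair [(A1, B1)] it follows that every predicate [∃ k ∀ b, X(e, k, b)] with [X ≤ₑ A1] is
    [Π⁰₄], since it says that [Z_e] is not of the form [e_op j B1].  For the pair [(A0, B0)], every
    set below [A0] is decidable in the jump of [B0], so the same equivalence with [X] c.e. turns each
    [Π⁰₃] predicate into one of the form [∃ k ∀ b, Y(e, k, b)] with [Y ≤ₑ B0 ≤ₑ A1].  Together they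
    put every [Σ⁰₄] predicate in [Π⁰₄], contradicting the hierarchy theorem. *)

(** * Cantor pairing *)

Notation "⟨ x , y ⟩" := (Cantor.to_nat (x, y)) (at level 0, format "⟨ x ,  y ⟩").
Notation π1 z := (fst (Cantor.of_nat z)).
Notation π2 z := (snd (Cantor.of_nat z)).

Lemma pair_π1 x y : π1 ⟨x, y⟩ = x.
Proof. now rewrite Cantor.cancel_of_to. Qed.

Lemma pair_π2 x y : π2 ⟨x, y⟩ = y.
Proof. now rewrite Cantor.cancel_of_to. Qed.

Lemma pair_eta z : ⟨π1 z, π2 z⟩ = z.
Proof. rewrite <- surjective_pairing. apply Cantor.cancel_to_of. Qed.

Lemma pair_le x y : x <= ⟨x, y⟩ /\ y <= ⟨x, y⟩.
Proof. pose proof (Cantor.to_nat_non_decreasing x y). lia. Qed.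

#[global] Opaque Cantor.to_nat Cantor.of_nat.

Ltac simp_pair := repeat (rewrite ?pair_π1, ?pair_π2 in *).

(** * Total recursive functions *)

Definition rec_fun (f : nat -> nat) : Prop := exists c, forall x, eval c x (f x).

Definition rec_bool (p : nat -> bool) : Prop := rec_fun (fun x => Nat.b2n (p x)).

Lemma rec_ext f g : (forall x, f x = g x) -> rec_fun f -> rec_fun g.
Proof. intros H [c Hc]. exists c. intro x. rewrite <- H. apply Hc. Qed.

Lemma rec_id : rec_fun (fun x => x).
Proof.
  exists (Pair Left Right). intro x. simpl. exists (π1 x), (π2 x).
  now rewrite pair_eta.
Qed.

Lemma rec_comp f g : rec_fun f -> rec_fun g -> rec_fun (fun x => f (g x)).
Proof. intros [c Hc] [d Hd]. exists (Comp c d). intro x. simpl. eauto. Qed.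

Lemma rec_succ f : rec_fun f -> rec_fun (fun x => S (f x)).
Proof. apply (rec_comp S). exists Succ. reflexivity. Qed.

Lemma rec_const n : rec_fun (fun _ => n).
Proof. induction n; [now exists Zero | now apply rec_succ]. Qed.

Lemma rec_pair f g : rec_fun f -> rec_fun g -> rec_fun (fun x => ⟨f x, g x⟩).
Proof. intros [c Hc] [d Hd]. exists (Pair c d). intro x. simpl. eauto 6. Qed.

Lemma rec_π1 f : rec_fun f -> rec_fun (fun x => π1 (f x)).
Proof. apply (rec_comp (fun x => π1 x)). exists Left. reflexivity. Qed.

Lemma rec_π2 f : rec_fun f -> rec_fun (fun x => π2 (f x)).
Proof. apply (rec_comp (fun x => π2 x)). exists Right. reflexivity. Qed.

(** Primitive recursion with a parameter: [g] receives parameter, counter and previous value in the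
    nesting of pairs that [Prec] fixes. *)
Lemma rec_nat_rect f g h :
  rec_fun f -> rec_fun (fun z => g (π1 z) (π1 (π2 z)) (π2 (π2 z))) -> rec_fun h ->
  rec_fun (fun x => nat_rect (fun _ => nat) (f x) (g x) (h x)).
Proof.
  intros [cf Hf] [cg Hg] Hh.
  apply (rec_ext (fun x => (fun z => nat_rect (fun _ => nat) (f (π1 z)) (g (π1 z)) (π2 z)) ⟨x, h x⟩)).
  { intro x. simpl. now simp_pair. }
  apply (rec_comp (fun z => nat_rect (fun _ => nat) (f (π1 z)) (g (π1 z)) (π2 z)) (fun x => ⟨x, h x⟩));
    [| apply rec_pair; [apply rec_id | exact Hh]].
  exists (Prec cf cg). intro z. simpl. destruct (Cantor.of_nat z) as [a n]. simpl.
  induction n as [|n IH]; simpl.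
  - apply Hf.
  - eexists. split; [exact IH |].
    specialize (Hg ⟨a, ⟨n, nat_rect (fun _ => nat) (f a) (g a) n⟩⟩).
    simp_pair. exact Hg.
Qed.

Lemma rec_add f g : rec_fun f -> rec_fun g -> rec_fun (fun x => f x + g x).
Proof.
  intros Hf Hg.
  apply (rec_ext (fun x => nat_rect (fun _ => nat) (f x) (fun _ r => S r) (g x))).
  - intro x. induction (g x); simpl; lia.
  - apply (rec_nat_rect f (fun _ _ r => S r) g); auto.
    apply rec_succ, rec_π2, rec_π2, rec_id.
Qed.

Lemma rec_mul f g : rec_fun f -> rec_fun g -> rec_fun (fun x => f x * g x).
Proof.
  intros Hf Hg.
  apply (rec_ext (fun x => nat_rect (fun _ => nat) 0 (fun _ r => r + f x) (g x))).
  - intro x. induction (g x) as [|n IH]; simpl; [lia | rewrite IH; lia].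
  - apply (rec_nat_rect (fun _ => 0) (fun x _ r => r + f x) g); auto using rec_const.
    apply rec_add; [apply rec_π2, rec_π2, rec_id | apply (rec_comp f); auto; apply rec_π1, rec_id].
Qed.

Lemma rec_pred f : rec_fun f -> rec_fun (fun x => pred (f x)).
Proof.
  intros Hf.
  apply (rec_ext (fun x => nat_rect (fun _ => nat) 0 (fun n _ => n) (f x))).
  - intro x. now destruct (f x).
  - apply (rec_nat_rect (fun _ => 0) (fun _ n _ => n) f); auto using rec_const.
    apply rec_π1, rec_π2, rec_id.
Qed.

Lemma rec_sub f g : rec_fun f -> rec_fun g -> rec_fun (fun x => f x - g x).
Proof.
  intros Hf Hg.
  apply (rec_ext (fun x => nat_rect (fun _ => nat) (f x) (fun _ r => pred r) (g x))).
  - intro x. induction (g x) as [|n IH]; simpl; [lia | rewrite IH; lia].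
  - apply (rec_nat_rect f (fun _ _ r => pred r) g); auto.
    apply rec_pred, rec_π2, rec_π2, rec_id.
Qed.

Lemma rec_negb p : rec_bool p -> rec_bool (fun x => negb (p x)).
Proof.
  intro Hp. refine (rec_ext _ _ _ (rec_sub _ _ (rec_const 1) Hp)).
  intro x. now destruct (p x).
Qed.

Lemma rec_andb p q : rec_bool p -> rec_bool q -> rec_bool (fun x => andb (p x) (q x)).
Proof.
  intros Hp Hq. refine (rec_ext _ _ _ (rec_mul _ _ Hp Hq)).
  intro x. now destruct (p x), (q x).
Qed.

Lemma rec_orb p q : rec_bool p -> rec_bool q -> rec_bool (fun x => orb (p x) (q x)).
Proof.
  intros Hp Hq.
  refine (rec_ext _ _ _ (rec_negb _ (rec_andb _ _ (rec_negb _ Hp) (rec_negb _ Hq)))).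
  intro x. now destruct (p x), (q x).
Qed.

Lemma rec_leb f g : rec_fun f -> rec_fun g -> rec_bool (fun x => f x <=? g x).
Proof.
  intros Hf Hg.
  refine (rec_ext _ _ _ (rec_sub _ _ (rec_const 1) (rec_sub _ _ Hf Hg))).
  intro x. destruct (Nat.leb_spec (f x) (g x)); simpl Nat.b2n; lia.
Qed.

Lemma rec_ltb f g : rec_fun f -> rec_fun g -> rec_bool (fun x => f x <? g x).
Proof. intros Hf Hg. apply (rec_leb (fun x => S (f x)) g); auto using rec_succ. Qed.

Lemma rec_eqb f g : rec_fun f -> rec_fun g -> rec_bool (fun x => f x =? g x).
Proof.
  intros Hf Hg. refine (rec_ext _ _ _ (rec_andb _ _ (rec_leb _ _ Hf Hg) (rec_leb _ _ Hg Hf))).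
  intro x. f_equal.
  destruct (Nat.leb_spec (f x) (g x)), (Nat.leb_spec (g x) (f x)), (Nat.eqb_spec (f x) (g x));
    simpl; try reflexivity; lia.
Qed.

Lemma rec_odd f : rec_fun f -> rec_bool (fun x => Nat.odd (f x)).
Proof.
  intro Hf.
  (* Parity flips at each successor, so it arises by iterating [1 - r] from 0. *)
  apply (rec_ext (fun x => nat_rect (fun _ => nat) 0 (fun _ r => 1 - r) (f x))).
  - intro x. generalize (f x) as a. induction a as [|n IH]; [reflexivity |].
    rewrite Nat.odd_succ, <- Nat.negb_odd.
    change (1 - nat_rect (fun _ => nat) 0 (fun _ r => 1 - r) n = Nat.b2n (negb (Nat.odd n))).
    cbv beta. rewrite IH. now destruct (Nat.odd n).
  - apply (rec_nat_rect (fun _ => 0) (fun _ _ r => 1 - r) f); auto using rec_const.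
    apply rec_sub; [apply rec_const | apply rec_π2, rec_π2, rec_id].
Qed.

Lemma rec_div2 f : rec_fun f -> rec_fun (fun x => Nat.div2 (f x)).
Proof.
  intro Hf.
  (* The half grows by one exactly when passing from an odd number to its successor. *)
  apply (rec_ext (fun x => nat_rect (fun _ => nat) 0 (fun n r => r + Nat.b2n (Nat.odd n)) (f x))).
  - intro x. induction (f x) as [|n IH]; [reflexivity |].
    change (nat_rect (fun _ => nat) 0 (fun n r => r + Nat.b2n (Nat.odd n)) n + Nat.b2n (Nat.odd n)
            = Nat.div2 (S n)).
    cbv beta. rewrite IH. pose proof (Nat.div2_odd n) as H1. pose proof (Nat.div2_odd (S n)) as H2.
    rewrite Nat.odd_succ, <- Nat.negb_odd in H2. destruct (Nat.odd n); simpl Nat.b2n in *; lia.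
  - apply (rec_nat_rect (fun _ => 0) (fun _ n r => r + Nat.b2n (Nat.odd n)) f); auto using rec_const.
    apply rec_add; [apply rec_π2, rec_π2, rec_id |].
    apply (rec_odd (fun z => π1 (π2 z))). apply rec_π1, rec_π2, rec_id.
Qed.

Lemma rec_testbit f g : rec_fun f -> rec_fun g -> rec_bool (fun x => Nat.testbit (f x) (g x)).
Proof.
  intros Hf Hg.
  apply (rec_ext (fun x => Nat.b2n (Nat.odd
           (nat_rect (fun _ => nat) (f x) (fun _ r => Nat.div2 r) (g x))))).
  - intro x. f_equal. generalize (f x) as a. induction (g x) as [|n IH]; intro a; [reflexivity |].
    change (Nat.testbit a (S n)) with (Nat.testbit (Nat.div2 a) n). rewrite <- IH. f_equal.
    clear IH. induction n as [|n IH]; simpl in *; [reflexivity | now rewrite IH].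
  - apply rec_odd. apply (rec_nat_rect f (fun _ _ r => Nat.div2 r) g); auto.
    apply rec_div2, rec_π2, rec_π2, rec_id.
Qed.

Definition ballb (n : nat) (p : nat -> bool) : bool :=
  nat_rect (fun _ => bool) true (fun i r => andb (p i) r) n.

Lemma ballb_spec n p : ballb n p = true <-> forall i, i < n -> p i = true.
Proof.
  induction n as [|n IH]; simpl.
  - split; [lia | reflexivity].
  - rewrite Bool.andb_true_iff. fold (ballb n p). rewrite IH. split.
    + intros [H1 H2] i Hi. destruct (Nat.eq_dec i n) as [->|]; auto. apply H2. lia.
    + intro H. split; [apply H; lia | intros i Hi; apply H; lia].
Qed.

Lemma rec_ballb p n :
  rec_bool (fun z => p (π1 z) (π2 z)) -> rec_fun n -> rec_bool (fun x => ballb (n x) (p x)).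
Proof.
  intros Hp Hn.
  apply (rec_ext (fun x => nat_rect (fun _ => nat) 1 (fun i r => Nat.b2n (p x i) * r) (n x))).
  - intro x. induction (n x) as [|k IH]; [reflexivity |]. simpl. rewrite IH. fold (ballb k (p x)).
    now destruct (p x k), (ballb k (p x)).
  - apply (rec_nat_rect (fun _ => 1) (fun x i r => Nat.b2n (p x i) * r) n); auto using rec_const.
    apply rec_mul; [| apply rec_π2, rec_π2, rec_id].
    refine (rec_ext _ _ _ (rec_comp _ (fun z => ⟨π1 z, π1 (π2 z)⟩) Hp _)).
    + intro z. simpl. now simp_pair.
    + apply rec_pair; [apply rec_π1 | apply rec_π1, rec_π2]; apply rec_id.
Qed.

Ltac rec_step :=
  lazymatch goal with
  | |- rec_fun (fun z => Cantor.to_nat (@?f z, @?g z)) => apply (rec_pair f g)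
  | |- rec_fun (fun z => fst (Cantor.of_nat (@?f z))) => apply (rec_π1 f)
  | |- rec_fun (fun z => snd (Cantor.of_nat (@?f z))) => apply (rec_π2 f)
  | |- rec_fun (fun z => z) => apply rec_id
  | |- rec_fun (fun _ => ?c) => apply (rec_const c)
  | |- rec_fun (fun z => S (@?f z)) => apply (rec_succ f)
  | H : rec_fun ?f |- rec_fun (fun z => ?f (@?h z)) => apply (rec_comp f h H)
  end.

Ltac rec_tac := cbv beta; repeat (rec_step; cbv beta).

(** * Semirecursive predicates *)

(** With a Boolean matrix, closure properties reduce to computations with [rec_bool]; [sigma1_ce]
    identifies the notion with [ce]. *)
Definition sigma1 (P : nset) : Prop :=
  exists p, rec_bool p /\ forall x, P x <-> exists y, p ⟨x, y⟩ = true.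

Lemma sigma1_ext P Q : (forall x, P x <-> Q x) -> sigma1 P -> sigma1 Q.
Proof. intros H [p [Hp E]]. exists p. split; auto. intro x. now rewrite <- H. Qed.

Lemma sigma1_bool p : rec_bool p -> sigma1 (fun x => p x = true).
Proof.
  intro Hp. exists (fun z => p (π1 z)). split.
  - apply (rec_comp (fun x => Nat.b2n (p x)) (fun z => π1 z)); auto. rec_tac.
  - intro x. split.
    + intro H. exists 0. now simp_pair.
    + intros [y H]. now simp_pair.
Qed.

Lemma sigma1_bool_false p : rec_bool p -> sigma1 (fun x => p x = false).
Proof.
  intro Hp. refine (sigma1_ext _ _ _ (sigma1_bool _ (rec_negb _ Hp))).
  intro x. apply Bool.negb_true_iff.
Qed.

Lemma sigma1_comp P h : sigma1 P -> rec_fun h -> sigma1 (fun x => P (h x)).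
Proof.
  intros [p [Hp E]] Hh. exists (fun z => p ⟨h (π1 z), π2 z⟩). split.
  - apply (rec_comp (fun x => Nat.b2n (p x)) (fun z => ⟨h (π1 z), π2 z⟩)); auto. rec_tac.
  - intro x. rewrite E. now split; intros [y H]; exists y; simp_pair.
Qed.

Lemma sigma1_and P Q : sigma1 P -> sigma1 Q -> sigma1 (fun x => P x /\ Q x).
Proof.
  intros [p [Hp E]] [q [Hq F]].
  exists (fun z => andb (p ⟨π1 z, π1 (π2 z)⟩) (q ⟨π1 z, π2 (π2 z)⟩)). split.
  - apply rec_andb.
    + apply (rec_comp (fun x => Nat.b2n (p x)) (fun z => ⟨π1 z, π1 (π2 z)⟩)); auto. rec_tac.
    + apply (rec_comp (fun x => Nat.b2n (q x)) (fun z => ⟨π1 z, π2 (π2 z)⟩)); auto. rec_tac.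
  - intro x. rewrite E, F. split.
    + intros [[y Hy] [y' Hy']]. exists ⟨y, y'⟩. simp_pair. now rewrite Hy, Hy'.
    + intros [y Hy]. simp_pair. apply Bool.andb_true_iff in Hy. split; eexists; apply Hy.
Qed.

Lemma sigma1_or P Q : sigma1 P -> sigma1 Q -> sigma1 (fun x => P x \/ Q x).
Proof.
  intros [p [Hp E]] [q [Hq F]].
  exists (fun z => orb (p z) (q z)). split.
  - now apply rec_orb.
  - intro x. rewrite E, F. split.
    + intros [[y Hy]|[y Hy]]; exists y; rewrite Hy; auto using Bool.orb_true_r.
    + intros [y Hy]. apply Bool.orb_true_iff in Hy. destruct Hy; eauto.
Qed.

Lemma sigma1_ex P : sigma1 (fun z => P (π1 z) (π2 z)) -> sigma1 (fun x => exists y, P x y).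
Proof.
  intros [p [Hp E]]. exists (fun z => p ⟨⟨π1 z, π1 (π2 z)⟩, π2 (π2 z)⟩). split.
  - apply (rec_comp (fun x => Nat.b2n (p x)) (fun z => ⟨⟨π1 z, π1 (π2 z)⟩, π2 (π2 z)⟩)); auto. rec_tac.
  - intro x. split.
    + intros [y Hy]. specialize (E ⟨x, y⟩). simp_pair. apply E in Hy. destruct Hy as [w Hw].
      exists ⟨y, w⟩. now simp_pair.
    + intros [t Ht]. simp_pair. exists (π1 t).
      specialize (E ⟨x, π1 t⟩). simp_pair. apply E. eauto.
Qed.

Lemma bounded_choice (n : nat) (P : nat -> nat -> Prop) :
  (forall i, i < n -> exists y, P i y) -> exists w, forall i, i < n -> exists y, y < w /\ P i y.
Proof.
  induction n as [|n IH]; intro H.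
  - exists 0. lia.
  - destruct IH as [w Hw]; [intros; apply H; lia |].
    destruct (H n) as [y Hy]; [lia |].
    exists (S (w + y)). intros i Hi. destruct (Nat.eq_dec i n) as [->|].
    + exists y. split; [lia | auto].
    + destruct (Hw i) as [y' [? ?]]; [lia |]. exists y'. split; [lia | auto].
Qed.

(** The single witness is a common bound below which every [i] finds its own witness; this bounded
    search is a negated [ballb]. *)
Lemma sigma1_ball P n :
  sigma1 (fun z => P (π1 z) (π2 z)) -> rec_fun n -> sigma1 (fun x => forall i, i < n x -> P x i).
Proof.
  intros [p [Hp E]] Hn.
  exists (fun z => ballb (n (π1 z)) (fun i => negb (ballb (π2 z) (fun y => negb (p ⟨⟨π1 z, i⟩, y⟩))))).
  split.
  - apply (rec_ballb (fun z i => negb (ballb (π2 z) (fun y => negb (p ⟨⟨π1 z, i⟩, y⟩))))); [| rec_tac].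
    apply rec_negb.
    apply (rec_ballb (fun z y => negb (p ⟨⟨π1 (π1 z), π2 z⟩, y⟩))); [| rec_tac].
    apply rec_negb.
    apply (rec_comp (fun x => Nat.b2n (p x)) (fun z => ⟨⟨π1 (π1 (π1 z)), π2 (π1 z)⟩, π2 z⟩)); auto.
    rec_tac.
  - intro x.
    assert (F : forall w i, negb (ballb w (fun y => negb (p ⟨⟨x, i⟩, y⟩))) = true <->
                exists y, y < w /\ p ⟨⟨x, i⟩, y⟩ = true).
    { intros w i. rewrite Bool.negb_true_iff. split.
      - intro H. apply NNPP. intro N. apply Bool.not_true_iff_false in H. apply H, ballb_spec.
        intros y Hy. apply Bool.negb_true_iff, Bool.not_true_iff_false. eauto.
      - intros [y [Hy H]]. apply Bool.not_true_iff_false. intro B.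
        rewrite ballb_spec in B. specialize (B y Hy). now rewrite H in B. }
    assert (E' : forall i, P x i <-> exists y, p ⟨⟨x, i⟩, y⟩ = true).
    { intro i. specialize (E ⟨x, i⟩). now simp_pair. }
    split.
    + intro H. destruct (bounded_choice (n x) (fun i y => p ⟨⟨x, i⟩, y⟩ = true)) as [w Hw].
      { intros i Hi. now apply E', H. }
      exists w. simp_pair. apply ballb_spec. intros i Hi. apply F. auto.
    + intros [w Hw] i Hi. simp_pair. rewrite ballb_spec in Hw. specialize (Hw i Hi).
      apply F in Hw. apply E'. destruct Hw as [y [_ Hy]]. eauto.
Qed.

Lemma sigma1_eq f g : rec_fun f -> rec_fun g -> sigma1 (fun x => f x = g x).
Proof.
  intros Hf Hg. refine (sigma1_ext _ _ _ (sigma1_bool _ (rec_eqb _ _ Hf Hg))).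
  intro x. apply Nat.eqb_eq.
Qed.

Lemma sigma1_lt f g : rec_fun f -> rec_fun g -> sigma1 (fun x => f x < g x).
Proof.
  intros Hf Hg. refine (sigma1_ext _ _ _ (sigma1_bool _ (rec_ltb _ _ Hf Hg))).
  intro x. apply Nat.ltb_lt.
Qed.

Lemma sigma1_le f g : rec_fun f -> rec_fun g -> sigma1 (fun x => f x <= g x).
Proof.
  intros Hf Hg. refine (sigma1_ext _ _ _ (sigma1_bool _ (rec_leb _ _ Hf Hg))).
  intro x. apply Nat.leb_le.
Qed.

Lemma sigma1_mem f g : rec_fun f -> rec_fun g -> sigma1 (fun x => fin_set (f x) (g x)).
Proof. intros Hf Hg. exact (sigma1_bool _ (rec_testbit _ _ Hf Hg)). Qed.

Lemma sigma1_not_mem f g : rec_fun f -> rec_fun g -> sigma1 (fun x => ~ fin_set (f x) (g x)).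
Proof.
  intros Hf Hg. refine (sigma1_ext _ _ _ (sigma1_bool _ (rec_negb _ (rec_testbit _ _ Hf Hg)))).
  intro x. unfold fin_set. rewrite Bool.negb_true_iff. now rewrite Bool.not_true_iff_false.
Qed.

Lemma fin_set_lt u i : fin_set u i -> i < u.
Proof.
  intro H. destruct (Nat.lt_ge_cases i u) as [|L]; auto.
  exfalso. unfold fin_set in H. rewrite Nat.testbit_eqb in H.
  rewrite Nat.div_small in H; [discriminate |].
  apply Nat.le_lt_trans with i; auto. apply Nat.pow_gt_lin_r. lia.
Qed.

Lemma sigma1_ball_mem P u :
  sigma1 (fun z => P (π1 z) (π2 z)) -> rec_fun u ->
  sigma1 (fun x => forall i, fin_set (u x) i -> P x i).
Proof.
  intros HP Hu.
  apply (sigma1_ext (fun x => forall i, i < u x -> ~ fin_set (u x) i \/ P x i)).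
  - intro x. split.
    + intros H i Hi. destruct (H i); auto using fin_set_lt. contradiction.
    + intros H i _. destruct (classic (fin_set (u x) i)); auto.
  - apply (sigma1_ball (fun x i => ~ fin_set (u x) i \/ P x i)); auto.
    apply sigma1_or; auto. apply sigma1_not_mem; rec_tac.
Qed.

Ltac s1_step :=
  lazymatch goal with
  | |- rec_fun _ => rec_step
  | |- sigma1 (fun x => exists y, @?P x y) => apply (sigma1_ex P)
  | |- sigma1 (fun x => @?P x /\ @?Q x) => apply (sigma1_and P Q)
  | |- sigma1 (fun x => @?P x \/ @?Q x) => apply (sigma1_or P Q)
  | |- sigma1 (fun x => forall i, i < @?n x -> @?P x i) => apply (sigma1_ball P n)
  | |- sigma1 (fun x => forall i, fin_set (@?n x) i -> @?P x i) => apply (sigma1_ball_mem P n)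
  | |- sigma1 (fun x => fin_set (@?f x) (@?g x)) => apply (sigma1_mem f g)
  | |- sigma1 (fun x => ~ fin_set (@?f x) (@?g x)) => apply (sigma1_not_mem f g)
  | |- sigma1 (fun x => @?f x = @?g x) => apply (sigma1_eq f g)
  | |- sigma1 (fun x => @?f x < @?g x) => apply (sigma1_lt f g)
  | |- sigma1 (fun x => @?f x <= @?g x) => apply (sigma1_le f g)
  | |- sigma1 (fun x => ?P (@?h x)) =>
      match goal with H : sigma1 P |- _ => apply (sigma1_comp P h H) end
  end.

Ltac s1_tac := cbv beta; repeat (s1_step; cbv beta).

(** * Finite sets *)

Lemma fin_set_0 i : ~ fin_set 0 i.
Proof. unfold fin_set. rewrite Nat.bits_0. discriminate. Qed.

Lemma fin_set_union u v : exists w, forall i, fin_set w i <-> fin_set u i \/ fin_set v i.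
Proof.
  exists (Nat.lor u v). intro i. unfold fin_set. rewrite Nat.lor_spec. apply Bool.orb_true_iff.
Qed.

Lemma fin_set_singleton x : exists u, forall i, fin_set u i <-> i = x.
Proof.
  exists (2 ^ x). intro i. unfold fin_set. rewrite Nat.pow2_bits_eqb, Nat.eqb_eq.
  split; congruence.
Qed.

Lemma fin_set_comprehension (P : nset) n : exists u, forall i, fin_set u i <-> i < n /\ P i.
Proof.
  induction n as [|n [u Hu]].
  - exists 0. intro i. split; [intro H; now apply fin_set_0 in H | lia].
  - destruct (classic (P n)) as [Hn|Hn].
    + destruct (fin_set_singleton n) as [v Hv]. destruct (fin_set_union u v) as [w Hw].
      exists w. intro i. rewrite Hw, Hu, Hv. split.
      * intros [[? ?]| ->]; split; auto; lia.
      * intros [L H]. destruct (Nat.eq_dec i n); [now right | left; split; [lia | auto]].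
    + exists u. intro i. rewrite Hu. split.
      * intros [? ?]; split; auto; lia.
      * intros [L H]. split; auto. destruct (Nat.eq_dec i n); [subst; contradiction | lia].
Qed.

(** Leaves only finitely many candidates for a finite set with bounded members, which [dump_bounded]
    exploits. *)
Lemma fin_set_bound u n : (forall i, fin_set u i -> i < n) -> u < 2 ^ n.
Proof.
  intro H. destruct (Nat.eq_dec u 0) as [->|Hu].
  - pose proof (Nat.pow_nonzero 2 n). lia.
  - apply Nat.log2_lt_pow2; [lia |]. apply H. apply Nat.bit_log2, Hu.
Qed.

(** * The universal semirecursive predicate *)

Fixpoint encode (c : code) : nat :=
  match c with
  | Zero => ⟨0, 0⟩
  | Succ => ⟨1, 0⟩
  | Left => ⟨2, 0⟩
  | Right => ⟨3, 0⟩
  | Pair f g => ⟨4, ⟨encode f, encode g⟩⟩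
  | Comp f g => ⟨5, ⟨encode f, encode g⟩⟩
  | Prec f g => ⟨6, ⟨encode f, encode g⟩⟩
  | Mu f => ⟨7, encode f⟩
  end.

(** A finite set [w] of triples [⟨c, ⟨x, y⟩⟩] certifies computations when each of its
    members is justified by others; subcodes make this well founded. *)
Definition justified (w t r x y : nat) : Prop :=
  (t = 0 /\ y = 0) \/
  (t = 1 /\ y = S x) \/
  (t = 2 /\ y = π1 x) \/
  (t = 3 /\ y = π2 x) \/
  (t = 4 /\ fin_set w ⟨π1 r, ⟨x, π1 y⟩⟩ /\ fin_set w ⟨π2 r, ⟨x, π2 y⟩⟩) \/
  (t = 5 /\ exists z, fin_set w ⟨π2 r, ⟨x, z⟩⟩ /\ fin_set w ⟨π1 r, ⟨z, y⟩⟩) \/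
  (t = 6 /\ π2 x = 0 /\ fin_set w ⟨π1 r, ⟨π1 x, y⟩⟩) \/
  (t = 6 /\ exists n s, π2 x = S n /\ fin_set w ⟨⟨6, r⟩, ⟨⟨π1 x, n⟩, s⟩⟩ /\
                        fin_set w ⟨π2 r, ⟨⟨π1 x, ⟨n, s⟩⟩, y⟩⟩) \/
  (t = 7 /\ fin_set w ⟨r, ⟨⟨x, y⟩, 0⟩⟩ /\
            forall m, m < y -> exists k, fin_set w ⟨r, ⟨⟨x, m⟩, S k⟩⟩).

Definition certificate (w : nat) : Prop :=
  forall z, fin_set w z -> justified w (π1 (π1 z)) (π2 (π1 z)) (π1 (π2 z)) (π2 (π2 z)).

Definition ueval (c x y : nat) : Prop := exists w, fin_set w ⟨c, ⟨x, y⟩⟩ /\ certificate w.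

(** Certificates turn the recursion on codes into one existential quantifier over [w]; the remaining
    universal quantifiers are bounded. *)
Lemma sigma1_ueval : sigma1 (fun z => ueval (π1 z) (π1 (π2 z)) (π2 (π2 z))).
Proof. unfold ueval, certificate, justified. s1_tac. Qed.

Lemma justified_mono w w' t r x y :
  (forall z, fin_set w z -> fin_set w' z) -> justified w t r x y -> justified w' t r x y.
Proof.
  intros H [J|[J|[J|[J|[J|[J|[J|[J|J]]]]]]]].
  - left. exact J.
  - right; left. exact J.
  - do 2 right; left. exact J.
  - do 3 right; left. exact J.
  - do 4 right; left. intuition.
  - do 5 right; left. destruct J as [E [z [J1 J2]]]. eauto 6.
  - do 6 right; left. intuition.
  - do 7 right; left. destruct J as [E [n [s [J1 [J2 J3]]]]]. eauto 10.
  - do 8 right. destruct J as [E [J1 J2]]. repeat split; auto.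
    intros m Hm. destruct (J2 m Hm) as [k Hk]. eauto.
Qed.

Lemma certificate_union w v :
  certificate w -> certificate v ->
  exists u, certificate u /\ forall i, fin_set u i <-> fin_set w i \/ fin_set v i.
Proof.
  intros Hw Hv. destruct (fin_set_union w v) as [u Hu]. exists u. split; auto.
  intros z Hz. apply Hu in Hz.
  destruct Hz as [Hz|Hz]; [apply justified_mono with w | apply justified_mono with v];
    auto; intros; apply Hu; auto.
Qed.

Lemma ueval_intro w c x y :
  certificate w -> justified w (π1 c) (π2 c) x y -> ueval c x y.
Proof.
  intros Hw J. destruct (fin_set_singleton ⟨c, ⟨x, y⟩⟩) as [v Hv].
  destruct (fin_set_union w v) as [u Hu]. exists u. split.
  - apply Hu. right. now apply Hv.
  - intros z Hz. apply Hu in Hz. apply justified_mono with w; [intros; apply Hu; auto |].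
    destruct Hz as [Hz|Hz]; auto. apply Hv in Hz. subst z. now simp_pair.
Qed.

Lemma certificate_0 : certificate 0.
Proof. intros z Hz. now apply fin_set_0 in Hz. Qed.

(** Needed for [Mu], whose justification refers to one computation for each [m < y]. *)
Lemma certificate_ball (P : nat -> nat -> Prop) n :
  (forall m, m < n -> exists w z, certificate w /\ fin_set w z /\ P m z) ->
  exists w, certificate w /\ forall m, m < n -> exists z, fin_set w z /\ P m z.
Proof.
  induction n as [|n IH]; intro H.
  - exists 0. split; [apply certificate_0 | lia].
  - destruct IH as [w [Hw Fw]]; [intros; apply H; lia |].
    destruct (H n) as [v [z [Hv [Fv Pv]]]]; [lia |].
    destruct (certificate_union w v Hw Hv) as [u [Cu Hu]].
    exists u. split; auto. intros m Hm. destruct (Nat.eq_dec m n) as [->|].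
    + exists z. split; auto. apply Hu. auto.
    + destruct (Fw m) as [z' [? ?]]; [lia |]. exists z'. split; auto. apply Hu. auto.
Qed.

Lemma eval_ueval c : forall x y, eval c x y -> ueval (encode c) x y.
Proof.
  induction c as [| | | |f IHf g IHg|f IHf g IHg|f IHf g IHg|f IHf]; intros x y E; cbn [encode].
  - apply (ueval_intro 0); [apply certificate_0 |]. simp_pair. left. auto.
  - apply (ueval_intro 0); [apply certificate_0 |]. simp_pair. right; left. auto.
  - apply (ueval_intro 0); [apply certificate_0 |]. simp_pair. do 2 right; left. auto.
  - apply (ueval_intro 0); [apply certificate_0 |]. simp_pair. do 3 right; left. auto.
  - destruct E as [a [b [Ea [Eb ->]]]].
    destruct (IHf _ _ Ea) as [w [Fw Cw]], (IHg _ _ Eb) as [v [Fv Cv]].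
    destruct (certificate_union w v Cw Cv) as [u [Cu Hu]].
    apply (ueval_intro u); auto. simp_pair. do 4 right; left. simp_pair.
    rewrite !Hu. auto.
  - destruct E as [z [Ea Eb]].
    destruct (IHg _ _ Ea) as [w [Fw Cw]], (IHf _ _ Eb) as [v [Fv Cv]].
    destruct (certificate_union w v Cw Cv) as [u [Cu Hu]].
    apply (ueval_intro u); auto. simp_pair. do 5 right; left. simp_pair.
    split; auto. exists z. rewrite !Hu. auto.
  - cbn [eval] in E. rewrite <- (pair_eta x).
    destruct (Cantor.of_nat x) as [a n]. cbn [fst snd]. clear x. revert y E.
    induction n as [|n IH]; cbn [nat_rect]; intros y E.
    + destruct (IHf _ _ E) as [w [Fw Cw]]. apply (ueval_intro w); auto.
      simp_pair. do 6 right; left. simp_pair. auto.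
    + destruct E as [r [Er E]]. destruct (IH _ Er) as [w [Fw Cw]], (IHg _ _ E) as [v [Fv Cv]].
      destruct (certificate_union w v Cw Cv) as [u [Cu Hu]].
      apply (ueval_intro u); auto. simp_pair. do 7 right; left. split; auto.
      exists n, r. simp_pair. rewrite !Hu. auto.
  - destruct E as [E0 E]. destruct (IHf _ _ E0) as [w [Fw Cw]].
    destruct (certificate_ball (fun m z => exists k, z = ⟨encode f, ⟨⟨x, m⟩, S k⟩⟩) y) as [v [Cv Hv]].
    { intros m Hm. destruct (E m Hm) as [k Hk]. destruct (IHf _ _ Hk) as [v [Fv Cv]]. eauto 7. }
    destruct (certificate_union w v Cw Cv) as [u [Cu Hu]].
    apply (ueval_intro u); auto. simp_pair. do 8 right. repeat split; auto.
    + apply Hu. auto.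
    + intros m Hm. destruct (Hv m Hm) as [z [Hz [k ->]]]. exists k. apply Hu. auto.
Qed.

(** Induction on the code suffices because justifications refer to subcodes. The one exception is
    the successor case of [Prec], which refers to the same code with a smaller counter and gets an
    inner induction. *)
Lemma ueval_eval c : forall x y, ueval (encode c) x y -> eval c x y.
Proof.
  intros x y [w [Fw Cw]]. revert x y Fw.
  induction c as [| | | |f IHf g IHg|f IHf g IHg|f IHf g IHg|f IHf]; intros x y F; cbn [encode] in *;
    [| | | | | | cbn [eval]; destruct (Cantor.of_nat x) as [a n] eqn:Ex;
       assert (x = ⟨a, n⟩) by (rewrite <- Ex; symmetry; apply Cantor.cancel_to_of); subst x;
       clear Ex; revert y F; induction n as [|n IH]; intros y F; cbn [nat_rect] |];
    apply Cw in F; simp_pair;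
    destruct F as [J|[J|[J|[J|[J|[J|[J|[J|J]]]]]]]]; destruct J as [E J]; try discriminate E; simp_pair.
  - exact J.
  - exact J.
  - exact J.
  - exact J.
  - destruct J as [J1 J2]. exists (π1 y), (π2 y). rewrite pair_eta. auto.
  - destruct J as [z [J1 J2]]. exists z. auto.
  - apply IHf, J.
  - destruct J as [n [s [N _]]]. discriminate.
  - destruct J as [N _]. discriminate.
  - destruct J as [m [s [N [J1 J2]]]]. injection N as <-. exists s. auto.
  - destruct J as [J1 J2]. split; auto. intros m Hm. destruct (J2 m Hm) as [k Hk]. eauto.
Qed.

Lemma eval_functional c : forall x y y', eval c x y -> eval c x y' -> y = y'.
Proof.
  induction c as [| | | |f IHf g IHg|f IHf g IHg|f IHf g IHg|f IHf]; cbn [eval]; intros x y y' E E';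
    try congruence.
  - destruct E as [a [b [Ea [Eb ->]]]], E' as [a' [b' [Ea' [Eb' ->]]]].
    now rewrite (IHf _ _ _ Ea Ea'), (IHg _ _ _ Eb Eb').
  - destruct E as [a [Ea Eb]], E' as [a' [Ea' Eb']].
    rewrite (IHg _ _ _ Ea Ea') in Eb. eauto.
  - destruct (Cantor.of_nat x) as [a n]. revert y y' E E'.
    induction n as [|n IH]; cbn [nat_rect]; intros y y' E E'; eauto.
    destruct E as [r [Er E]], E' as [r' [Er' E']]. rewrite (IH _ _ Er Er') in E. eauto.
  - destruct E as [E0 E], E' as [E0' E'].
    destruct (Nat.lt_trichotomy y y') as [L|[L|L]]; auto.
    + destruct (E' y L) as [k Hk]. discriminate (IHf _ _ _ E0 Hk).
    + destruct (E y' L) as [k Hk]. discriminate (IHf _ _ _ E0' Hk).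
Qed.

(** [Mu] applied to the negated matrix, where 0 stands for truth, finds the least witness.
    Conversely, convergence of a code is semirecursive by [sigma1_ueval]. *)
Lemma sigma1_ce W : sigma1 W <-> ce W.
Proof.
  split.
  - intros [p [Hp E]]. destruct (rec_negb p Hp) as [c Hc]. exists (Mu c).
    intro x. rewrite E. cbn [eval]. split.
    + intros [y Hy]. induction y as [y IH] using lt_wf_ind.
      destruct (classic (exists z, z < y /\ p ⟨x, z⟩ = true)) as [[z [L Hz]]|N]; eauto.
      exists y. split.
      * specialize (Hc ⟨x, y⟩). now rewrite Hy in Hc.
      * intros m Hm. exists 0. specialize (Hc ⟨x, m⟩).
        destruct (p ⟨x, m⟩) eqn:Ep; auto. exfalso. eauto.
    + intros [y [Hy _]]. exists y. specialize (Hc ⟨x, y⟩).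
      destruct (p ⟨x, y⟩); auto. discriminate (eval_functional _ _ _ _ Hy Hc).
  - intros [c Hc]. apply (sigma1_ext (fun x => exists y, ueval (encode c) x y)).
    + intro x. rewrite Hc. split; intros [y H]; exists y; auto using ueval_eval, eval_ueval.
    + refine (sigma1_ex _ (sigma1_ext _ _ _ (sigma1_comp _ (fun z => ⟨encode c, z⟩) sigma1_ueval _))).
      * intro z. cbv beta. now simp_pair.
      * rec_tac.
Qed.

Definition univ (z : nat) : Prop := exists y, ueval (π1 z) (π2 z) y.

Lemma sigma1_univ : sigma1 univ.
Proof.
  unfold univ. apply (sigma1_ex (fun z y => ueval (π1 z) (π2 z) y)).
  refine (sigma1_ext _ _ _ (sigma1_comp _ (fun z => ⟨π1 (π1 z), ⟨π2 (π1 z), π2 z⟩⟩) sigma1_ueval _)).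
  - intro z. cbv beta. now simp_pair.
  - rec_tac.
Qed.

Lemma univ_spec W : sigma1 W -> exists i, forall x, W x <-> univ ⟨i, x⟩.
Proof.
  rewrite sigma1_ce. intros [c Hc]. exists (encode c). intro x. unfold univ. simp_pair.
  rewrite Hc. split; intros [y H]; exists y; auto using ueval_eval, eval_ueval.
Qed.

(** * Sets enumeration reducible to a given set *)

Lemma e_le_sigma1_iff S B :
  S ≤ₑ B <-> exists G, sigma1 G /\ forall x, S x <-> enum_op G B x.
Proof. split; intros [G [HG H]]; exists G; split; auto; now apply sigma1_ce. Qed.

Lemma e_le_ext P Q B : (forall x, P x <-> Q x) -> P ≤ₑ B -> Q ≤ₑ B.
Proof. intros H [G [HG E]]. exists G. split; auto. intro x. now rewrite <- H. Qed.

Lemma e_le_refl B : B ≤ₑ B.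
Proof.
  apply e_le_sigma1_iff. exists (fun z => fin_set (π2 z) (π1 z)). split; [s1_tac |].
  intro x. split.
  - intro H. destruct (fin_set_singleton x) as [u Hu]. exists u. simp_pair. split.
    + intros i Hi. apply Hu in Hi. now subst.
    + now apply Hu.
  - intros [u [Hu H]]. simp_pair. auto.
Qed.

Lemma e_le_sigma1 S B : sigma1 S -> S ≤ₑ B.
Proof.
  intro H. apply e_le_sigma1_iff. exists (fun z => S (π1 z)). split; [s1_tac |].
  intro x. split.
  - intro Hx. exists 0. simp_pair. split; auto. intros i Hi. now apply fin_set_0 in Hi.
  - intros [u [_ Hx]]. now simp_pair.
Qed.

Lemma e_le_empty B : (fun _ => False) ≤ₑ B.
Proof.
  apply e_le_sigma1, (sigma1_ext (fun x => 0 = 1)); [intro; split; [discriminate | tauto] |].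
  s1_tac.
Qed.

Lemma e_le_comp S B h : S ≤ₑ B -> rec_fun h -> (fun x => S (h x)) ≤ₑ B.
Proof.
  rewrite !e_le_sigma1_iff. intros [G [HG E]] Hh. exists (fun z => G ⟨h (π1 z), π2 z⟩).
  split; [s1_tac |]. intro x. rewrite E. unfold enum_op.
  now split; intros [u H]; exists u; simp_pair.
Qed.

Lemma e_le_or P Q B : P ≤ₑ B -> Q ≤ₑ B -> (fun x => P x \/ Q x) ≤ₑ B.
Proof.
  rewrite !e_le_sigma1_iff. intros [G [HG E]] [H [HH F]]. exists (fun z => G z \/ H z). split.
  - apply sigma1_or; auto.
  - intro x. rewrite E, F. unfold enum_op. firstorder.
Qed.

Lemma e_le_ex P B : (fun z => P (π1 z) (π2 z)) ≤ₑ B -> (fun x => exists y, P x y) ≤ₑ B.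
Proof.
  rewrite !e_le_sigma1_iff. intros [G [HG E]].
  exists (fun z => exists y, G ⟨⟨π1 z, y⟩, π2 z⟩). split; [s1_tac |].
  intro x. split.
  - intros [y Hy]. specialize (E ⟨x, y⟩). simp_pair. apply E in Hy. destruct Hy as [u [Hu Hy]].
    exists u. split; auto. exists y. now simp_pair.
  - intros [u [Hu [y Hy]]]. exists y. specialize (E ⟨x, y⟩). simp_pair. apply E. exists u. auto.
Qed.

(** The finite parts of [B] used for the finitely many [i] are merged into one finite set, from
    which every [i] selects its own part [v]. *)
Lemma e_le_ball P B n :
  (fun z => P (π1 z) (π2 z)) ≤ₑ B -> rec_fun n -> (fun x => forall i, i < n x -> P x i) ≤ₑ B.
Proof.
  rewrite !e_le_sigma1_iff. intros [G [HG E]] Hn.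
  exists (fun z => forall i, i < n (π1 z) ->
            exists v, (forall j, fin_set v j -> fin_set (π2 z) j) /\ G ⟨⟨π1 z, i⟩, v⟩).
  split; [s1_tac |].
  assert (E' : forall x i, P x i <-> enum_op G B ⟨x, i⟩).
  { intros x i. specialize (E ⟨x, i⟩). now simp_pair. }
  intro x. split.
  - intro H.
    assert (F : forall k, (forall i, i < k -> P x i) ->
      exists u, (forall i, fin_set u i -> B i) /\ forall i, i < k ->
      exists v, (forall j, fin_set v j -> fin_set u j) /\ G ⟨⟨x, i⟩, v⟩).
    { clear H. induction k as [|k IH]; intro H.
      - exists 0. split; [| lia]. intros i Hi. now apply fin_set_0 in Hi.
      - destruct IH as [u [Hu F]]; [intros; apply H; lia |].
        destruct (proj1 (E' x k)) as [v [Hv Gv]]; [apply H; lia |].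
        destruct (fin_set_union u v) as [w Hw]. exists w. split.
        + intros i Hi. apply Hw in Hi. destruct Hi; auto.
        + intros i Hi. destruct (Nat.eq_dec i k) as [->|].
          * exists v. split; auto. intros; apply Hw; auto.
          * destruct (F i) as [v' [? ?]]; [lia |]. exists v'. split; auto. intros; apply Hw; auto. }
    destruct (F (n x) H) as [u [Hu Fu]]. exists u. simp_pair. auto.
  - intros [u [Hu H]] i Hi. simp_pair. destruct (H i Hi) as [v [Hv Gv]].
    apply E'. exists v. auto.
Qed.

Lemma e_le_and P Q B : P ≤ₑ B -> Q ≤ₑ B -> (fun x => P x /\ Q x) ≤ₑ B.
Proof.
  rewrite !e_le_sigma1_iff. intros [G [HG E]] [H [HH F]].
  exists (fun z => exists v w, (forall j, fin_set v j -> fin_set (π2 z) j) /\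
                               (forall j, fin_set w j -> fin_set (π2 z) j) /\
                               G ⟨π1 z, v⟩ /\ H ⟨π1 z, w⟩).
  split; [s1_tac |]. intro x. rewrite E, F. split.
  - intros [[v [Hv Gv]] [w [Hw Gw]]]. destruct (fin_set_union v w) as [u Hu]. exists u. split.
    + intros i Hi. apply Hu in Hi. destruct Hi; auto.
    + exists v, w. simp_pair. repeat split; auto; intros; apply Hu; auto.
  - intros [u [Hu [v [w [Hv [Hw [Gv Gw]]]]]]]. simp_pair. split; [exists v | exists w]; auto.
Qed.

Lemma e_le_ball_mem P B u :
  (fun z => P (π1 z) (π2 z)) ≤ₑ B -> rec_fun u ->
  (fun x => forall i, fin_set (u x) i -> P x i) ≤ₑ B.
Proof.
  intros HP Hu.
  apply (e_le_ext (fun x => forall i, i < u x -> ~ fin_set (u x) i \/ P x i)).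
  - intro x. split.
    + intros H i Hi. destruct (H i); auto using fin_set_lt. contradiction.
    + intros H i _. destruct (classic (fin_set (u x) i)); auto.
  - apply (e_le_ball (fun x i => ~ fin_set (u x) i \/ P x i)); auto.
    apply e_le_or; auto. apply e_le_sigma1. s1_tac.
Qed.

(** Sets reducible to [B] may be combined positively: by conjunction, disjunction, existential and
    bounded universal quantifiers. Parts that are c.e. as a whole, possibly with decidable negations
    inside, are discharged first. *)
Ltac e_step :=
  match goal with
  | |- rec_fun _ => rec_step
  | |- e_le (fun x => ?P (@?h x)) ?B =>
      match goal with H : e_le P B |- _ => apply (e_le_comp P B h H) end
  | |- e_le _ _ => apply e_le_sigma1; solve [s1_tac]
  | |- e_le (fun x => exists y, @?P x y) ?B => apply (e_le_ex P B)
  | |- e_le (fun x => @?P x /\ @?Q x) ?B => apply (e_le_and P Q B)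
  | |- e_le (fun x => @?P x \/ @?Q x) ?B => apply (e_le_or P Q B)
  | |- e_le (fun x => forall i, i < @?n x -> @?P x i) ?B => apply (e_le_ball P B n)
  | |- e_le (fun x => forall i, fin_set (@?n x) i -> @?P x i) ?B => apply (e_le_ball_mem P B n)
  end.

Ltac e_tac := cbv beta; repeat (e_step; cbv beta).

Lemma e_le_trans S B C : S ≤ₑ B -> B ≤ₑ C -> S ≤ₑ C.
Proof.
  rewrite e_le_sigma1_iff. intros [G [HG E]] HB.
  apply (e_le_ext (fun x => exists u, (forall i, fin_set u i -> B i) /\ G ⟨x, u⟩)).
  - intro x. now rewrite E.
  - e_tac.
Qed.

Definition e_op (j : nat) (B : nset) : nset := enum_op (fun z => univ ⟨j, z⟩) B.

Lemma e_op_spec S B : S ≤ₑ B <-> exists j, forall x, S x <-> e_op j B x.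
Proof.
  rewrite e_le_sigma1_iff. split.
  - intros [G [HG E]]. destruct (univ_spec G HG) as [j Hj]. exists j. intro x. rewrite E.
    unfold e_op, enum_op. now split; intros [u [Hu H]]; exists u; split; auto; apply Hj.
  - intros [j E]. exists (fun z => univ ⟨j, z⟩). split; auto.
    pose proof sigma1_univ. s1_tac.
Qed.

(** Uniformity in the index, so that equations with [e_op j B] can be classified with [j] as a
    variable. *)
Lemma e_op_e_le B : (fun z => e_op (π1 z) B (π2 z)) ≤ₑ B.
Proof.
  pose proof sigma1_univ. pose proof (e_le_refl B). unfold e_op, enum_op. e_tac.
Qed.

(** * Sets in the second level of the arithmetical hierarchy *)

(** The inner universal quantifier is hidden in the complement of a c.e. set [W], which collects the
    refuted witnesses. *)
Definition sigma2 (A : nset) : Prop :=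
  exists W, sigma1 W /\ forall x, A x <-> exists a, ~ W ⟨x, a⟩.

Lemma sigma2_Sigma02 A : sigma2 A <-> Sigma02 A.
Proof.
  split.
  - intros [W [[p [Hp E]] H]].
    exists (fun z => p ⟨⟨π1 z, π1 (π2 z)⟩, π2 (π2 z)⟩ = false). split.
    + assert (R : rec_bool (fun z => negb (p ⟨⟨π1 z, π1 (π2 z)⟩, π2 (π2 z)⟩))).
      { apply rec_negb.
        apply (rec_comp (fun x => Nat.b2n (p x)) (fun z => ⟨⟨π1 z, π1 (π2 z)⟩, π2 (π2 z)⟩)); auto.
        rec_tac. }
      destruct R as [c Hc]. exists c. intro z. specialize (Hc z). cbv beta in Hc.
      destruct (p ⟨⟨π1 z, π1 (π2 z)⟩, π2 (π2 z)⟩); [right | left]; split; auto; discriminate.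
    + intro x. rewrite H. split; intros [a Ha]; exists a.
      * intro b. simp_pair. apply Bool.not_true_iff_false. intro N. apply Ha, E. eauto.
      * intro N. apply E in N. destruct N as [b Hb]. specialize (Ha b). simp_pair. congruence.
  - intros [R [[c Hc] H]].
    exists (fun z => exists b, ueval (encode c) ⟨π1 z, ⟨π2 z, b⟩⟩ 0). split.
    + apply (sigma1_ex (fun z b => ueval (encode c) ⟨π1 z, ⟨π2 z, b⟩⟩ 0)).
      refine (sigma1_ext _ _ _ (sigma1_comp _
        (fun z => ⟨encode c, ⟨⟨π1 (π1 z), ⟨π2 (π1 z), π2 z⟩⟩, 0⟩⟩) sigma1_ueval _)).
      * intro z. cbv beta. now simp_pair.
      * rec_tac.
    + intro x. rewrite H. split; intros [a Ha]; exists a.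
      * intros [b Hb]. simp_pair. apply ueval_eval in Hb.
        destruct (Hc ⟨x, ⟨a, b⟩⟩) as [[_ E]|[N _]]; [| auto].
        discriminate (eval_functional _ _ _ _ Hb E).
      * intro b. destruct (Hc ⟨x, ⟨a, b⟩⟩) as [[R1 _]|[_ E]]; auto.
        exfalso. apply Ha. exists b. simp_pair. now apply eval_ueval.
Qed.

(** An axiom, its enumeration stage and witnesses for all elements it uses are guessed at once; that
    such a guess is wrong is a c.e. event. *)
Lemma sigma2_e_le S A : S ≤ₑ A -> sigma2 A -> sigma2 S.
Proof.
  rewrite e_le_sigma1_iff. intros [G [[p [Hp E]] H]] [W [HW F]].
  (* [t] codes the finite set [u], a step count [y] for [G] and a finite set [w] of pairs
     [⟨i, a⟩] in which [a] witnesses [i ∈ A]. *)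
  exists (fun z => p ⟨⟨π1 z, π1 (π2 z)⟩, π1 (π2 (π2 z))⟩ = false \/
    (exists i, fin_set (π1 (π2 z)) i /\
       forall a, a < π2 (π2 (π2 z)) -> ~ fin_set (π2 (π2 (π2 z))) ⟨i, a⟩) \/
    (exists q, fin_set (π2 (π2 (π2 z))) q /\ W q)).
  split.
  - apply sigma1_or; [| s1_tac].
    apply (sigma1_comp (fun x => p x = false) (fun z => ⟨⟨π1 z, π1 (π2 z)⟩, π1 (π2 (π2 z))⟩));
      [now apply sigma1_bool_false | rec_tac].
  - intro x. rewrite H. split.
    + intros [u [Hu Gu]]. apply E in Gu. destruct Gu as [y Hy].
      destruct (bounded_choice u (fun i a => fin_set u i -> ~ W ⟨i, a⟩)) as [n Hn].
      { intros i _. destruct (classic (fin_set u i)) as [Hi|Hi].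
        - apply Hu, F in Hi. destruct Hi as [a Ha]. eauto.
        - exists 0. contradiction. }
      (* [m] exceeds all pairs [⟨i, a⟩] with [i < u] and [a < n], so comprehension below [m]
         captures the required witnesses. *)
      destruct (bounded_choice u (fun i b => forall a, a < n -> ⟨i, a⟩ < b)) as [m Hm].
      { intros i _. clear. induction n as [|n [b Hb]]; [exists 0; lia |].
        exists (S (b + ⟨i, n⟩)). intros a Ha. destruct (Nat.eq_dec a n) as [->|]; [lia |].
        specialize (Hb a). lia. }
      destruct (fin_set_comprehension (fun q => fin_set u (π1 q) /\ ~ W q) m) as [w Hw].
      exists ⟨u, ⟨y, w⟩⟩. simp_pair. intros [N|[[i [Hi N]]|[q [Hq N]]]].
      * congruence.
      * destruct (Hn i) as [a [La Ha]]; [now apply fin_set_lt |].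
        destruct (Hm i) as [b [Lb Hb]]; [now apply fin_set_lt |].
        assert (Q : fin_set w ⟨i, a⟩).
        { apply Hw. simp_pair. specialize (Hb a La). repeat split; auto. lia. }
        apply (N a); auto. apply fin_set_lt in Q. pose proof (pair_le i a). lia.
      * apply Hw in Hq. tauto.
    + intros [t Ht]. simp_pair. exists (π1 t). split.
      * intros i Hi. apply NNPP. intro N. apply Ht. right; left. exists i. split; auto.
        intros a _ Ha. apply N, F. exists a. intro Wa. apply Ht. eauto 6.
      * apply E. exists (π1 (π2 t)). apply Bool.not_false_iff_true. auto.
Qed.

(** * Joins *)

Definition e_join (X Y : nset) : nset := fun z => (π1 z = 0 /\ X (π2 z)) \/ (π1 z = 1 /\ Y (π2 z)).

Lemma e_join_l X Y : X ≤ₑ e_join X Y.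
Proof.
  apply (e_le_ext (fun x => e_join X Y ⟨0, x⟩)).
  - intro x. unfold e_join. simp_pair. intuition discriminate.
  - pose proof (e_le_refl (e_join X Y)). e_tac.
Qed.

Lemma e_join_r X Y : Y ≤ₑ e_join X Y.
Proof.
  apply (e_le_ext (fun x => e_join X Y ⟨1, x⟩)).
  - intro x. unfold e_join. simp_pair. intuition discriminate.
  - pose proof (e_le_refl (e_join X Y)). e_tac.
Qed.

Lemma e_join_lub X Y B : X ≤ₑ B -> Y ≤ₑ B -> e_join X Y ≤ₑ B.
Proof. intros HX HY. unfold e_join. e_tac. Qed.

(** * A set that computes [A] exactly when a given condition holds *)

Lemma least_number (P : nset) : (exists n, P n) -> exists n, P n /\ forall m, m < n -> ~ P m.
Proof.
  intros [n H]. induction n as [n IH] using lt_wf_ind.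
  destruct (classic (exists m, m < n /\ P m)) as [[m [L Hm]]|N]; eauto.
  exists n. split; auto. intros m L Hm. eauto.
Qed.

Lemma bounded_sup (n : nat) (P : nat -> nat -> Prop) :
  (forall i, i < n -> exists b, forall x, P i x -> x < b) ->
  exists b, forall i x, i < n -> P i x -> x < b.
Proof.
  intro H. destruct (bounded_choice n (fun i b => forall x, P i x -> x < b) H) as [w Hw].
  exists w. intros i x Hi Hx. destruct (Hw i Hi) as [b [L Hb]]. specialize (Hb x Hx). lia.
Qed.

(** [overapprox D ⟨⟨i, p⟩, ⟨y, u⟩⟩]: the axiom [⟨y, u⟩] of the [i]-th operator applies to the set
    whose column 0 is [D], whose columns [1, ..., i] are given by the finite set [p], and whose
    other columns are full. *)
Definition overapprox (D : nset) : nset := fun z =>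
  univ ⟨π1 (π1 z), π2 z⟩ /\
  forall v, fin_set (π2 (π2 z)) v ->
    (π1 v = 0 /\ D (π2 v)) \/ π1 (π1 z) < π1 v \/
    (exists c, π1 v = S c /\ fin_set (π2 (π1 z)) ⟨c, π2 v⟩).

(** [agree A D W W' ⟨q, ⟨⟨y, u⟩, a⟩⟩]: [a] does not witness a difference at [y] between [A] and
    [{y | exists u, overapprox D ⟨q, ⟨y, u⟩⟩}].  Here [W], [W'] are the sets of refuted witnesses
    for [A] and [overapprox D], so that agreement is a positive condition on [A]. *)
Definition agree (A D W W' : nset) : nset := fun z =>
  (W' ⟨⟨π1 z, π1 (π2 z)⟩, π2 (π2 z)⟩ \/ A (π1 (π1 (π2 z)))) /\
  (W ⟨π1 (π1 (π2 z)), π2 (π2 z)⟩ \/ exists u, overapprox D ⟨π1 z, ⟨π1 (π1 (π2 z)), u⟩⟩).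

(** The index [y] itself is included, so even [y = 0] makes a demand on [X]; an empty row of [X]
    thus has no initial segments. *)
Definition initial_seg (X : nset) (e k y : nat) : Prop := forall b, b < S y -> X ⟨e, ⟨k, b⟩⟩.

(** The guess [⟨i, p⟩] supports [x] if no difference shows below [x]. The members of [p] need only
    be possible elements of earlier columns, a condition that is positive in [dump] and [X]. *)
Definition dump_step (A D W W' X : nset) (w e c x : nat) : Prop :=
  exists i p, i <= c /\
    (forall z, fin_set p z -> π1 z < c /\ (fin_set w ⟨e, z⟩ \/ initial_seg X e (π1 z) (π2 z))) /\
    forall m, m < x -> agree A D W W' ⟨⟨i, p⟩, m⟩.

(** [dump ⟨e, ⟨c, x⟩⟩] means [x <= s e c], where [s e c] is the least number bounding the first
    difference for every [⟨i, p⟩] such that [i <= c] and [p] is consistent with the columns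
    before [c]; the finite set [w] certifies the recursion on [c]. *)
Definition dump (A D W W' X : nset) : nset := fun t =>
  exists w, fin_set w t /\
    forall z, fin_set w z -> dump_step A D W W' X w (π1 z) (π1 (π2 z)) (π2 (π2 z)).

(** Column 0 holds [D]. If [s] is the largest number with [dump ⟨e, ⟨k, s⟩⟩], then column [S k] of
    row [e] contains everything below [s], contains [s] if [k] is in [A], and also copies [A] along
    [initial_seg]. *)
Definition coded (A D W W' X : nset) : nset := fun t =>
  (π1 (π2 t) = 0 /\ D (π2 (π2 t))) \/
  exists k, π1 (π2 t) = S k /\
    (dump A D W W' X ⟨π1 t, ⟨k, S (π2 (π2 t))⟩⟩ \/
     (dump A D W W' X ⟨π1 t, ⟨k, π2 (π2 t)⟩⟩ /\ A k) \/
     (initial_seg X (π1 t) k (π2 (π2 t)) /\ A (π2 (π2 t)))).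

Lemma overapprox_e_le D : overapprox D ≤ₑ D.
Proof. pose proof sigma1_univ. pose proof (e_le_refl D). unfold overapprox. e_tac. Qed.

(** [A] occurs only positively, since in [agree] its negative side is expressed through the c.e.
    sets [W] and [W']. *)
Lemma dump_e_le A D W W' X :
  D ≤ₑ A -> X ≤ₑ A -> sigma1 W -> sigma1 W' -> dump A D W W' X ≤ₑ A.
Proof.
  intros HD HX HW HW'. pose proof (e_le_refl A) as HA.
  pose proof (e_le_trans _ _ _ (overapprox_e_le D) HD) as HV.
  assert (HO : agree A D W W' ≤ₑ A) by (unfold agree; e_tac).
  unfold dump, dump_step, initial_seg. e_tac.
Qed.

Lemma coded_e_le A D W W' X :
  D ≤ₑ A -> X ≤ₑ A -> sigma1 W -> sigma1 W' -> coded A D W W' X ≤ₑ A.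
Proof.
  intros HD HX HW HW'. pose proof (e_le_refl A) as HA.
  pose proof (dump_e_le A D W W' X HD HX HW HW'). unfold coded, initial_seg. e_tac.
Qed.

Lemma dump_step_mono A D W W' X w w' e c x :
  (forall z, fin_set w z -> fin_set w' z) ->
  dump_step A D W W' X w e c x -> dump_step A D W W' X w' e c x.
Proof.
  intros H [i [p [Hi [Hp Hx]]]]. exists i, p. split; [| split]; auto.
  intros z Hz. destruct (Hp z Hz) as [? [?|?]]; auto.
Qed.

(** Together with [dump_elim] this is the recursion equation of [dump], free of certificates: those
    of the members of [p] are merged and the new triple is added. *)
Lemma dump_intro A D W W' X e c x i p :
  i <= c ->
  (forall z, fin_set p z -> π1 z < c /\ (dump A D W W' X ⟨e, z⟩ \/ initial_seg X e (π1 z) (π2 z))) ->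
  (forall m, m < x -> agree A D W W' ⟨⟨i, p⟩, m⟩) ->
  dump A D W W' X ⟨e, ⟨c, x⟩⟩.
Proof.
  intros Hi Hp Hx.
  set (cert := fun w => forall z, fin_set w z ->
    dump_step A D W W' X w (π1 z) (π1 (π2 z)) (π2 (π2 z))).
  assert (U : forall v w, cert v -> cert w ->
    exists u, cert u /\ forall z, fin_set u z <-> fin_set v z \/ fin_set w z).
  { intros v w Hv Hw. destruct (fin_set_union v w) as [u Hu]. exists u. split; auto.
    intros z Hz. apply Hu in Hz.
    destruct Hz; [apply dump_step_mono with v | apply dump_step_mono with w]; auto;
      intros; apply Hu; auto. }
  assert (F : forall n, exists w, cert w /\ forall z, z < n -> fin_set p z ->
    fin_set w ⟨e, z⟩ \/ initial_seg X e (π1 z) (π2 z)).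
  { induction n as [|n [w [Cw Hw]]].
    - exists 0. split; [| lia]. intros z Hz. now apply fin_set_0 in Hz.
    - destruct (classic (fin_set p n)) as [Hn|Hn].
      + destruct (Hp n Hn) as [_ [[v [Fv Cv]]|L]].
        * destruct (U v w Cv Cw) as [u [Cu Hu]]. exists u. split; auto.
          intros z Hz Fz. destruct (Nat.eq_dec z n) as [->|]; [left; apply Hu; auto |].
          destruct (Hw z) as [?|?]; auto; [lia | left; apply Hu; auto].
        * exists w. split; auto. intros z Hz Fz. destruct (Nat.eq_dec z n) as [->|]; auto.
          apply Hw; auto; lia.
      + exists w. split; auto. intros z Hz Fz. destruct (Nat.eq_dec z n) as [->|]; [contradiction |].
        apply Hw; auto; lia. }
  destruct (F p) as [w [Cw Hw]].
  destruct (fin_set_singleton ⟨e, ⟨c, x⟩⟩) as [v Hv]. destruct (fin_set_union w v) as [u Hu].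
  exists u. split; [apply Hu; right; now apply Hv |].
  intros z Hz. apply dump_step_mono with w; [intros; apply Hu; auto |].
  apply Hu in Hz. destruct Hz as [Hz|Hz]; [now apply Cw |].
  apply Hv in Hz. subst z. simp_pair. exists i, p. split; [| split]; auto.
  intros z Hz. split; [now apply Hp |]. apply Hw; auto. now apply fin_set_lt.
Qed.

Lemma dump_elim A D W W' X e c x :
  dump A D W W' X ⟨e, ⟨c, x⟩⟩ ->
  exists i p, i <= c /\
  (forall z, fin_set p z -> π1 z < c /\ (dump A D W W' X ⟨e, z⟩ \/ initial_seg X e (π1 z) (π2 z))) /\
  (forall m, m < x -> agree A D W W' ⟨⟨i, p⟩, m⟩).
Proof.
  intros [w [Fw Cw]]. destruct (Cw _ Fw) as [i [p [Hi [Hp Hx]]]]. simp_pair.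
  exists i, p. split; [| split]; auto.
  intros z Hz. destruct (Hp z Hz) as [? [?|?]]; auto. split; auto. left. exists w. auto.
Qed.

(** Without a difference, [A] would be the set enumerated from the overapproximation, hence
    reducible to [D]. *)
Lemma difference_exists A D W W' q :
  ~ A ≤ₑ D ->
  (forall x, A x <-> exists a, ~ W ⟨x, a⟩) ->
  (forall x, overapprox D x <-> exists a, ~ W' ⟨x, a⟩) ->
  exists m, ~ agree A D W W' ⟨q, m⟩.
Proof.
  intros ND HA HV. apply NNPP. intro N. apply ND.
  assert (O : forall m, agree A D W W' ⟨q, m⟩) by (intro m; apply NNPP; eauto). clear N.
  apply (e_le_ext (fun y => exists u, overapprox D ⟨q, ⟨y, u⟩⟩)).
  - intro y. split.
    + intros [u Hu]. apply HV in Hu. destruct Hu as [a Ha].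
      destruct (O ⟨⟨y, u⟩, a⟩) as [H _]. simp_pair. tauto.
    + intro Hy. pose proof Hy as Hy'. apply HA in Hy'. destruct Hy' as [a Ha].
      (* Here 0 is a default in the place of [u]: the second clause of [agree] quantifies over
         axioms itself. *)
      destruct (O ⟨⟨y, 0⟩, a⟩) as [_ H]. simp_pair. tauto.
  - pose proof (overapprox_e_le D). e_tac.
Qed.

(** By induction the columns before [c] offer only finitely many possible elements, so finitely many
    guesses [⟨i, p⟩] compete, and each one stops at its difference. *)
Lemma dump_bounded A D W W' X e c :
  (forall q, exists m, ~ agree A D W W' ⟨q, m⟩) ->
  (forall k, k < c -> exists b, ~ X ⟨e, ⟨k, b⟩⟩) ->
  exists n, forall x, dump A D W W' X ⟨e, ⟨c, x⟩⟩ -> x < n.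
Proof.
  intros HO. induction c as [c IH] using lt_wf_ind. intro HX.
  destruct (bounded_sup c (fun k z => exists y, z = ⟨k, y⟩ /\
    (dump A D W W' X ⟨e, ⟨k, y⟩⟩ \/ initial_seg X e k y))) as [n Hn].
  { intros k Hk. destruct (IH k Hk) as [b Hb]; [intros; apply HX; lia |].
    destruct (HX k Hk) as [b' Hb'].
    destruct (bounded_sup (b + b') (fun y z => z = ⟨k, y⟩)) as [n Hn].
    { intros y _. exists (S ⟨k, y⟩). intros; lia. }
    exists n. intros z [y [-> [H|H]]]; apply (Hn y); auto.
    - specialize (Hb y H). lia.
    - destruct (Nat.lt_ge_cases y b') as [|L]; [lia |]. exfalso. apply Hb', H. lia. }
  destruct (bounded_sup (S c) (fun i x => exists p, p < 2 ^ n /\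
    forall m, m < x -> agree A D W W' ⟨⟨i, p⟩, m⟩)) as [b Hb].
  { intros i _.
    destruct (bounded_sup (2 ^ n) (fun p x => forall m, m < x -> agree A D W W' ⟨⟨i, p⟩, m⟩)) as [b Hb].
    { intros p _. destruct (HO ⟨i, p⟩) as [m Hm]. exists (S m). intros x Hx.
      destruct (Nat.lt_ge_cases x (S m)); auto. exfalso. apply Hm, Hx. lia. }
    exists b. intros x [p [Hp Hx]]. eauto. }
  exists b. intros x H. apply dump_elim in H. destruct H as [i [p [Hi [Hp Hx]]]].
  apply (Hb i); [lia |]. exists p. split; auto. apply fin_set_bound. intros z Hz.
  destruct (Hp z Hz) as [Hc Hd]. apply (Hn (π1 z)); auto. exists (π2 z).
  now rewrite pair_eta.
Qed.

Lemma dump_0 A D W W' X e c : dump A D W W' X ⟨e, ⟨c, 0⟩⟩.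
Proof.
  apply (dump_intro A D W W' X e c 0 0 0); try lia.
  intros z Hz. now apply fin_set_0 in Hz.
Qed.

(** For the least [k] whose condition on [X] never fails, the dump in its column is bounded by some
    [n]. From [n] on this column is a copy of [A]; the part of [A] below [n] is a finite patch. *)
Lemma coded_computes A D W W' X e :
  (forall q, exists m, ~ agree A D W W' ⟨q, m⟩) ->
  (exists k, forall b, X ⟨e, ⟨k, b⟩⟩) ->
  A ≤ₑ (fun x => coded A D W W' X ⟨e, x⟩).
Proof.
  intros HO HX. apply least_number in HX. destruct HX as [k [Hk Hmin]].
  destruct (dump_bounded A D W W' X e k HO) as [n Hn].
  { intros j Hj. specialize (Hmin j Hj). now apply not_all_ex_not in Hmin. }
  destruct (fin_set_comprehension A n) as [u Hu].
  set (Z := fun x => coded A D W W' X ⟨e, x⟩).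
  apply (e_le_ext (fun y => fin_set u y \/ (n <= y /\ Z ⟨S k, y⟩))).
  - intro y. rewrite Hu. split.
    + intros [[_ H]|[L H]]; auto. unfold Z, coded in H. simp_pair.
      destruct H as [[H _]|[j [E H]]]; [discriminate |]. injection E as <-.
      destruct H as [H|[[H _]|[_ H]]]; auto; apply Hn in H; lia.
    + intro H. destruct (Nat.lt_ge_cases y n) as [|L]; auto. right. split; auto.
      right. exists k. simp_pair. split; auto. right; right. split; auto. intros b _. apply Hk.
  - pose proof (e_le_refl Z). e_tac.
Qed.

(* The overapproximation [⟨i, p⟩] in which [p] records the true columns [1, ..., i] differs from
   [A]. A first difference in [A] refutes [A = e_op i Z] since [Z] is overapproximated, and a first
   difference outside [A] does so because the axiom involved has been dumped into [Z]. *)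
Lemma coded_not_computes A D W W' X e :
  (forall x, A x <-> exists a, ~ W ⟨x, a⟩) ->
  (forall x, overapprox D x <-> exists a, ~ W' ⟨x, a⟩) ->
  (forall q, exists m, ~ agree A D W W' ⟨q, m⟩) ->
  (forall k, exists b, ~ X ⟨e, ⟨k, b⟩⟩) ->
  ~ A ≤ₑ (fun x => coded A D W W' X ⟨e, x⟩).
Proof.
  intros HA HV HO HX H. set (Z := fun x => coded A D W W' X ⟨e, x⟩) in *.
  apply e_op_spec in H. destruct H as [i Hi].
  assert (R : forall k y, Z ⟨S k, y⟩ -> dump A D W W' X ⟨e, ⟨k, y⟩⟩ \/
                                       dump A D W W' X ⟨e, ⟨k, S y⟩⟩ \/ initial_seg X e k y).
  { intros k y [H|H]; simp_pair; [destruct H; discriminate |].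
    destruct H as [k' [E H]]. injection E as <-. tauto. }
  (* The columns 1 to [i] are finite, so the finite set [p] can record them exactly. *)
  destruct (bounded_sup i (fun k z => exists y, z = ⟨k, y⟩ /\ Z ⟨S k, y⟩)) as [n Hn].
  { intros k Hk. destruct (dump_bounded A D W W' X e k HO) as [b Hb]; [auto |].
    destruct (HX k) as [b' Hb'].
    destruct (bounded_sup (b + b') (fun y z => z = ⟨k, y⟩)) as [n Hn].
    { intros y _. exists (S ⟨k, y⟩). intros; lia. }
    exists n. intros z [y [-> Hy]]. apply (Hn y); auto.
    apply R in Hy. destruct Hy as [Hy|[Hy|Hy]].
    - specialize (Hb y Hy). lia.
    - specialize (Hb (S y) Hy). lia.
    - destruct (Nat.lt_ge_cases y b') as [|L]; [lia |]. exfalso. apply Hb', Hy. lia. }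
  destruct (fin_set_comprehension (fun z => π1 z < i /\ Z ⟨S (π1 z), π2 z⟩) n) as [p Hp].
  destruct (least_number _ (HO ⟨i, p⟩)) as [m [Hm Hmin]].
  (* From column [i + 1] on, the guess [⟨i, p⟩] is admissible and agrees below its first difference
     [m], so all numbers below [m] are dumped. *)
  assert (full : forall c y, i <= c -> y < m -> Z ⟨S c, y⟩).
  { intros c y Hc Hy. right. exists c. simp_pair. split; auto. left.
    apply (dump_intro A D W W' X e c (S y) i p); auto.
    - intros z Hz. apply Hp in Hz. destruct Hz as [_ [Lz Hz]]. split; [lia |].
      apply R in Hz. rewrite pair_eta in Hz. destruct Hz as [Hz|[Hz|Hz]]; auto.
      left. rewrite <- (pair_eta z).
      apply dump_elim in Hz. destruct Hz as [i' [p' [? [? Hx]]]].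
      apply (dump_intro A D W W' X e _ _ i' p'); auto.
    - intros m' Hm'. apply NNPP. apply Hmin. lia. }
  assert (HZ : forall v, Z v -> (π1 v = 0 /\ D (π2 v)) \/ i < π1 v \/
                          (exists c, π1 v = S c /\ fin_set p ⟨c, π2 v⟩)).
  { intros v Hv. destruct (π1 v) as [|c] eqn:Ev.
    - left. split; auto. destruct Hv as [[_ H]|[c [E _]]]; simp_pair; [exact H | congruence].
    - right. destruct (Nat.lt_ge_cases c i) as [L|L]; [right | left; lia].
      exists c. split; auto. apply Hp. simp_pair.
      assert (Z ⟨S c, π2 v⟩) by (rewrite <- Ev, pair_eta; exact Hv).
      split; auto. apply (Hn c); eauto. }
  (* Decoded as [⟨⟨y, u⟩, a⟩], the difference [m] dominates the code [u] and hence all elements that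
     the axiom uses, so [full] covers them. *)
  apply Hm. clear Hm. rewrite <- (pair_eta m) in *. set (a := π2 m) in *.
  rewrite <- (pair_eta (π1 m)) in *. set (y := π1 (π1 m)) in *. set (u := π2 (π1 m)) in *.
  split; simp_pair.
  - apply NNPP. intro N. apply not_or_and in N. destruct N as [N Ny].
    apply Ny, Hi. assert (V : overapprox D ⟨⟨i, p⟩, ⟨y, u⟩⟩) by (apply HV; eauto).
    destruct V as [V1 V2]. simp_pair. exists u. split; auto.
    intros v Hv. rewrite <- (pair_eta v). destruct (V2 v Hv) as [[E Dv]|[L|[c [E Fc]]]].
    + left. simp_pair. auto.
    + destruct (π1 v) as [|c] eqn:Ev; [lia |]. apply full; [lia |].
      apply fin_set_lt in Hv. pose proof (pair_le (π1 v) (π2 v)) as Q. rewrite pair_eta in Q.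
      pose proof (pair_le y u). pose proof (pair_le ⟨y, u⟩ a). lia.
    + rewrite E. apply Hp in Fc. simp_pair. tauto.
  - apply NNPP. intro N. apply not_or_and in N. destruct N as [N Ny].
    assert (Ay : A y) by (apply HA; eauto). apply Hi in Ay. destruct Ay as [u' [Hu' Uu']].
    apply Ny. exists u'. split; simp_pair; auto.
Qed.

(** With row [e] of [X] empty, column [S k] is decided by [dump] except at the largest dumped
    position, where the bit of [A] at [k] is stored. *)
Lemma coded_recovers A D W W' X e k :
  (forall q, exists m, ~ agree A D W W' ⟨q, m⟩) ->
  (forall v, ~ X ⟨e, v⟩) ->
  A k <-> forall y, coded A D W W' X ⟨e, ⟨S k, y⟩⟩ \/ ~ dump A D W W' X ⟨e, ⟨k, y⟩⟩.
Proof.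
  intros HO HX. split.
  - intros Hk y. destruct (classic (dump A D W W' X ⟨e, ⟨k, y⟩⟩)); auto.
    left. right. exists k. simp_pair. auto.
  - intro H. destruct (dump_bounded A D W W' X e k HO) as [n Hn]; [intros; exists 0; auto |].
    destruct (least_number (fun y => ~ dump A D W W' X ⟨e, ⟨k, y⟩⟩)) as [y [Hy Hmin]].
    { exists n. intro N. apply Hn in N. lia. }
    (* The least position that is not dumped is positive by [dump_0], and its predecessor carries
       the bit. *)
    destruct y as [|y]; [exfalso; apply Hy, dump_0 |].
    destruct (H y) as [Z|N]; [| exfalso; apply (Hmin y); auto].
    destruct Z as [[E _]|[k' [E Z]]]; simp_pair; [discriminate |]. injection E as <-.
    destruct Z as [Z|[[_ Z]|[Z _]]]; auto; [contradiction |].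
    exfalso. apply (HX ⟨k, 0⟩), Z. lia.
Qed.

(** Interface of the construction. The last clause describes [A] positively by [Z] and negatively by
    the Σ⁰₂ set [L], the shape that [pi2_in] can absorb. *)
Lemma coding A D X :
  sigma2 A -> D ≤ₑ A -> ~ A ≤ₑ D -> X ≤ₑ A ->
  exists Z L, Z ≤ₑ A /\ sigma2 L /\ forall e,
    D ≤ₑ (fun x => Z ⟨e, x⟩) /\
    ((exists k, forall b, X ⟨e, ⟨k, b⟩⟩) <-> A ≤ₑ (fun x => Z ⟨e, x⟩)) /\
    ((forall v, ~ X ⟨e, v⟩) -> forall k, A k <-> forall y, Z ⟨e, ⟨S k, y⟩⟩ \/ ~ L ⟨e, ⟨k, y⟩⟩).
Proof.
  intros SA HD ND HX.
  pose proof (sigma2_e_le _ _ (e_le_trans _ _ _ (overapprox_e_le D) HD) SA) as [W' [HW' E']].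
  pose proof SA as [W [HW E]].
  pose proof (fun q => difference_exists A D W W' q ND E E') as HO.
  exists (coded A D W W' X), (dump A D W W' X). split; [now apply coded_e_le |].
  split; [apply sigma2_e_le with A; auto; now apply dump_e_le |].
  intro e. split; [| split].
  - set (Z := fun x => coded A D W W' X ⟨e, x⟩).
    apply (e_le_ext (fun x => Z ⟨0, x⟩)).
    + intro x. unfold Z, coded. simp_pair. split.
      * intros [[_ H]|[k [N _]]]; [auto | discriminate].
      * auto.
    + pose proof (e_le_refl Z). e_tac.
  - split; [now apply coded_computes |].
    intro H. apply NNPP. intro N. revert H. apply coded_not_computes; auto.
    intro k. apply not_all_ex_not. intro K. eauto.
  - intros N k. now apply coded_recovers.
Qed.

(** * Relativized Ahmad pairs *)

(** [ahmad A B D]: above [D], the degree of [A] is the left half of an Ahmad pair with right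
    half [B]. *)
Definition ahmad (A B D : nset) : Prop :=
  ~ A ≤ₑ B /\ D ≤ₑ A /\ D ≤ₑ B /\ forall Z, D ≤ₑ Z -> Z ≤ₑ A -> A ≤ₑ Z \/ Z ≤ₑ B.

Lemma ahmad_not_le A B D : ahmad A B D -> ~ A ≤ₑ D.
Proof. intros [N [_ [H _]]] L. apply N. now apply e_le_trans with D. Qed.

(** For c.e. [B] this is the class Π⁰₂. *)
Definition pi2_in (B S : nset) : Prop := exists X, X ≤ₑ B /\ forall z, S z <-> forall b, X ⟨z, b⟩.

Lemma pi2_in_ext B P Q : (forall z, P z <-> Q z) -> pi2_in B P -> pi2_in B Q.
Proof. intros H [X [HX E]]. exists X. split; auto. intro z. now rewrite <- H. Qed.

Lemma pi2_in_e_le B S : S ≤ₑ B -> pi2_in B S.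
Proof.
  intro H. exists (fun z => S (π1 z)). split; [e_tac |].
  intro z. split; [intros Hz b; now simp_pair | intro Hz; specialize (Hz 0); now simp_pair].
Qed.

Lemma pi2_in_compl B S : sigma2 S -> pi2_in B (fun z => ~ S z).
Proof.
  intros [W [HW E]]. exists W. split; [now apply e_le_sigma1 |].
  intro z. rewrite E. split.
  - intros N b. apply NNPP. eauto.
  - intros H [a Ha]. auto.
Qed.

Lemma pi2_in_comp B S h : pi2_in B S -> rec_fun h -> pi2_in B (fun x => S (h x)).
Proof.
  intros [X [HX E]] Hh. exists (fun z => X ⟨h (π1 z), π2 z⟩). split; [e_tac |].
  intro z. rewrite E. split; intros H b; specialize (H b); now simp_pair.
Qed.

(** Classically, two universal quantifiers under a disjunction merge into one over pairs, with a
    matrix that stays positive. *)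
Lemma pi2_in_or B P Q : pi2_in B P -> pi2_in B Q -> pi2_in B (fun x => P x \/ Q x).
Proof.
  intros [X [HX E]] [Y [HY F]].
  exists (fun z => X ⟨π1 z, π1 (π2 z)⟩ \/ Y ⟨π1 z, π2 (π2 z)⟩). split; [e_tac |].
  intro z. rewrite E, F. split.
  - intros [H|H] b; simp_pair; auto.
  - intro H. destruct (classic (forall b, X ⟨z, b⟩)) as [|N]; auto.
    apply not_all_ex_not in N. destruct N as [b Hb]. right. intro b'.
    specialize (H ⟨b, b'⟩). simp_pair. tauto.
Qed.

Lemma pi2_in_and B P Q : pi2_in B P -> pi2_in B Q -> pi2_in B (fun x => P x /\ Q x).
Proof.
  intros [X [HX E]] [Y [HY F]]. exists (fun z => X z /\ Y z). split; [e_tac |].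
  intro z. rewrite E, F. firstorder.
Qed.

Lemma pi2_in_all B P : pi2_in B (fun z => P (π1 z) (π2 z)) -> pi2_in B (fun x => forall y, P x y).
Proof.
  intros [X [HX E]]. exists (fun z => X ⟨⟨π1 z, π1 (π2 z)⟩, π2 (π2 z)⟩). split; [e_tac |].
  intro z. split.
  - intros H b. simp_pair. specialize (E ⟨z, π1 b⟩). simp_pair. now apply E.
  - intros H y. specialize (E ⟨z, y⟩). simp_pair. apply E. intro b.
    specialize (H ⟨y, b⟩). now simp_pair.
Qed.

(** For empty [X] the coded set does not compute [A], hence lies below [B], and the recovery clause
    of [coding] expresses [A] through it. *)
Lemma ahmad_left_pi2_in A B D : sigma2 A -> ahmad A B D -> pi2_in B A.
Proof.
  intros SA HP. pose proof HP as [NB [DA [DB H]]].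
  destruct (coding A D (fun _ => False)) as [Z [L [HZ [SL C]]]]; auto.
  - now apply ahmad_not_le with B.
  - apply e_le_empty.
  - destruct (C 0) as [DZ [CZ RZ]]. set (Z0 := fun x => Z ⟨0, x⟩) in *.
    assert (H0 : Z0 ≤ₑ B).
    { destruct (H Z0) as [N|]; auto; [unfold Z0; e_tac |].
      apply CZ in N. destruct N as [k N]. destruct (N 0). }
    apply (pi2_in_ext B (fun k => forall y, Z0 ⟨S k, y⟩ \/ ~ L ⟨0, ⟨k, y⟩⟩)).
    { intro k. symmetry. apply RZ. tauto. }
    apply (pi2_in_all B (fun k y => Z0 ⟨S k, y⟩ \/ ~ L ⟨0, ⟨k, y⟩⟩)). apply pi2_in_or.
    + apply pi2_in_e_le. e_tac.
    + apply (pi2_in_comp B (fun z => ~ L z) (fun z => ⟨0, ⟨π1 z, π2 z⟩⟩)); [| rec_tac].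
      now apply pi2_in_compl.
Qed.

(** The join of [Z] with [D] either lies below [B], or computes [A] and then is itself the left half
    of a pair with [B]. *)
Lemma ahmad_below_pi2_in A B D Z : sigma2 A -> ahmad A B D -> Z ≤ₑ A -> pi2_in B Z.
Proof.
  intros SA HP HZ. pose proof HP as [NB [DA [DB H]]].
  pose proof (e_join_lub Z D A HZ DA) as JA.
  destruct (H (e_join Z D)) as [K|K]; auto using e_join_r.
  - assert (P : ahmad (e_join Z D) B D).
    { split; [| split; [| split]]; auto using e_join_r.
      - intro N. apply NB. now apply e_le_trans with (e_join Z D).
      - intros Y DY YJ. destruct (H Y) as [|]; auto.
        + now apply e_le_trans with (e_join Z D).
        + left. now apply e_le_trans with A. }
    apply ahmad_left_pi2_in in P; [| now apply sigma2_e_le with A].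
    refine (pi2_in_ext B _ _ _ (pi2_in_comp B _ (fun x => ⟨0, x⟩) P _)).
    + intro x. unfold e_join. simp_pair. intuition discriminate.
    + rec_tac.
  - apply pi2_in_e_le. apply e_le_trans with (e_join Z D); auto using e_join_l.
Qed.

(** For sets between [D] and [A], failing to compute [A] means lying below [B], which is the
    existence of an operator index [j]. *)
Lemma ahmad_coding A B D X :
  sigma2 A -> ahmad A B D -> X ≤ₑ A ->
  exists Z, Z ≤ₑ A /\ forall e,
    ~ (exists k, forall b, X ⟨e, ⟨k, b⟩⟩) <-> exists j, forall x, Z ⟨e, x⟩ <-> e_op j B x.
Proof.
  intros SA HP HX. pose proof HP as [NB [DA [DB H]]].
  destruct (coding A D X) as [Z [L [HZ [_ C]]]]; auto.
  { now apply ahmad_not_le with B. }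
  exists Z. split; auto. intro e. destruct (C e) as [DZ [CZ _]].
  set (Ze := fun x => Z ⟨e, x⟩) in *. rewrite CZ.
  change (~ A ≤ₑ Ze <-> exists j, forall x, Ze x <-> e_op j B x). rewrite <- e_op_spec.
  split.
  - intro N. destruct (H Ze); auto; [unfold Ze; e_tac | contradiction].
  - intros K N. apply NB. now apply e_le_trans with Ze.
Qed.

(* The right half decides the negation of every [Σ⁰₃] question as one of its own [Σ₂(B')]
   questions. *)
Lemma ahmad_right_high A B D X :
  sigma2 A -> sigma2 B -> ahmad A B D -> sigma1 X ->
  exists Y, Y ≤ₑ B /\ forall e,
    ~ (exists k, forall b, X ⟨e, ⟨k, b⟩⟩) <-> exists j, forall b, Y ⟨e, ⟨j, b⟩⟩.
Proof.
  intros SA SB HP HX. destruct (ahmad_coding A B D X) as [Z [HZ C]]; auto using e_le_sigma1.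
  assert (SZ : sigma2 Z) by now apply sigma2_e_le with A.
  pose proof (e_op_e_le B) as HU. set (U := fun z => e_op (π1 z) B (π2 z)) in *.
  assert (SU : sigma2 U) by now apply sigma2_e_le with B.
  (* With [z] read as [⟨e, j⟩], this is the equality of row [e] of [Z] with [e_op j B]. Positive
     occurrences of [Z] rest on the Ahmad pair, negative ones of [Z] and [U] on their being Σ⁰₂. *)
  assert (K : pi2_in B (fun z => forall x, (Z ⟨π1 z, x⟩ \/ ~ U ⟨π2 z, x⟩) /\
                                           (~ Z ⟨π1 z, x⟩ \/ U ⟨π2 z, x⟩))).
  { apply (pi2_in_all B (fun z x => (Z ⟨π1 z, x⟩ \/ ~ U ⟨π2 z, x⟩) /\
                                    (~ Z ⟨π1 z, x⟩ \/ U ⟨π2 z, x⟩))).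
    apply pi2_in_and; apply pi2_in_or.
    - apply (pi2_in_comp B Z (fun z => ⟨π1 (π1 z), π2 z⟩)); [| rec_tac].
      now apply ahmad_below_pi2_in with A D.
    - apply (pi2_in_comp B (fun z => ~ U z) (fun z => ⟨π2 (π1 z), π2 z⟩)); [| rec_tac].
      now apply pi2_in_compl.
    - apply (pi2_in_comp B (fun z => ~ Z z) (fun z => ⟨π1 (π1 z), π2 z⟩)); [| rec_tac].
      now apply pi2_in_compl.
    - apply (pi2_in_comp B U (fun z => ⟨π2 (π1 z), π2 z⟩)); [| rec_tac].
      now apply pi2_in_e_le. }
  destruct K as [Y [HY EY]].
  exists (fun z => Y ⟨⟨π1 z, π1 (π2 z)⟩, π2 (π2 z)⟩). split; [e_tac |].
  intro e. rewrite C.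
  assert (Q : forall j, (forall x, Z ⟨e, x⟩ <-> e_op j B x) <-> forall b, Y ⟨⟨e, j⟩, b⟩).
  { intro j. rewrite <- EY. unfold U. simp_pair. split; intros H x; specialize (H x); simp_pair.
    - destruct (classic (Z ⟨e, x⟩)); tauto.
    - tauto. }
  split; intros [j Hj]; exists j.
  - intro b. simp_pair. now apply Q.
  - apply Q. intro b. specialize (Hj b). now simp_pair.
Qed.

(** * Collapse of the arithmetical hierarchy along a chain of pairs *)

(** An implication between Σ⁰₂ statements says that every witness [a] of the first is refuted at
    some stage [b], or some [d] witnesses the second; this is Π⁰₃. *)
Lemma sigma2_iff_pi3 P Q :
  sigma2 P -> sigma2 Q ->
  exists W, sigma1 W /\ forall z, (P (π1 z) <-> Q (π2 z)) <-> forall l, exists b, ~ W ⟨z, ⟨l, b⟩⟩.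
Proof.
  intros [V [HV E]] [W [HW F]]. pose proof HV as [v [Rv Ev]]. pose proof HW as [w [Rw Ew]].
  pose proof (sigma1_bool_false v Rv) as Nv. pose proof (sigma1_bool_false w Rw) as Nw.
  set (v0 := fun x => v x = false) in *. set (w0 := fun x => w x = false) in *.
  exists (fun t =>
    (v0 ⟨⟨π1 (π1 t), π1 (π1 (π2 t))⟩, π1 (π1 (π2 (π2 t)))⟩ /\
     W ⟨π2 (π1 t), π2 (π1 (π2 (π2 t)))⟩) \/
    (w0 ⟨⟨π2 (π1 t), π2 (π1 (π2 t))⟩, π1 (π2 (π2 (π2 t)))⟩ /\
     V ⟨π1 (π1 t), π2 (π2 (π2 (π2 t)))⟩)).
  split; [s1_tac |].
  assert (K : forall p q (V W : nset) (v : nat -> bool),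
    (forall x, V x <-> exists y, v ⟨x, y⟩ = true) ->
    ((exists a, ~ V ⟨p, a⟩) -> exists a, ~ W ⟨q, a⟩) <->
    forall a, exists b d, ~ (v ⟨⟨p, a⟩, b⟩ = false /\ W ⟨q, d⟩)).
  { clear. intros p q V W v Ev. split.
    - intros H a. destruct (classic (V ⟨p, a⟩)) as [Va|Va].
      + apply Ev in Va. destruct Va as [b Hb]. exists b, 0. rewrite Hb. now intros [? _].
      + destruct H as [d Hd]; [eauto |]. exists 0, d. tauto.
    - intros H [a Ha]. destruct (H a) as [b [d Hd]]. exists d. intro Wd. apply Hd. split; auto.
      apply Bool.not_true_iff_false. intro Hv. apply Ha, Ev. eauto. }
  intro z. rewrite E, F.
  pose proof (K (π1 z) (π2 z) V W v Ev) as K1. pose proof (K (π2 z) (π1 z) W V w Ew) as K2. split.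
  - intros [H1 H2] l.
    destruct (proj1 K1 H1 (π1 l)) as [b [d Hd]], (proj1 K2 H2 (π2 l)) as [b' [d' Hd']].
    exists ⟨⟨b, d⟩, ⟨b', d'⟩⟩. unfold v0, w0. simp_pair. tauto.
  - intro H. split; [apply K1 | apply K2]; intro a.
    + destruct (H ⟨a, 0⟩) as [b Hb]. unfold v0, w0 in Hb. simp_pair.
      exists (π1 (π1 b)), (π2 (π1 b)). tauto.
    + destruct (H ⟨0, a⟩) as [b Hb]. unfold v0, w0 in Hb. simp_pair.
      exists (π1 (π2 b)), (π2 (π2 b)). tauto.
Qed.

(** The first pair and the link [B0 ≤ₑ A1] make the diagonal predicate a question about rows of a
    set below [A1]. The second pair makes its negation Σ⁰₄ as well, with some index [i], and at [i]
    the predicate is equivalent to its negation. *)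
Lemma no_ahmad_chain A0 B0 D0 A1 B1 D1 :
  sigma2 A0 -> sigma2 B0 -> sigma2 A1 -> sigma2 B1 ->
  ahmad A0 B0 D0 -> ahmad A1 B1 D1 -> ~ B0 ≤ₑ A1.
Proof.
  intros SA0 SB0 SA1 SB1 H0 H1 L. pose proof sigma1_univ as HU.
  (* The diagonal [Σ⁰₄] predicate of [e] is [∃ k ∀ l ∃ b ¬ univ ⟨e, ⟨e, ⟨k, ⟨l, b⟩⟩⟩⟩]. *)
  destruct (ahmad_right_high A0 B0 D0 (fun z => univ ⟨π1 (π1 z), ⟨π1 (π1 z), ⟨π2 (π1 z), π2 z⟩⟩⟩))
    as [Y [HY EY]]; auto; [s1_tac |].
  pose proof (e_le_trans _ _ _ HY L) as HY'.
  (* The column number codes [⟨k, j⟩], which merges the outer [k] of the diagonal predicate with the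
     [j] supplied by [EY]. *)
  destruct (ahmad_coding A1 B1 D1
    (fun z => Y ⟨⟨π1 z, π1 (π1 (π2 z))⟩, ⟨π2 (π1 (π2 z)), π2 (π2 z)⟩⟩)) as [Z [HZ EZ]]; auto; [e_tac |].
  destruct (sigma2_iff_pi3 Z (fun z => e_op (π1 z) B1 (π2 z))) as [W [HW EW]].
  { now apply sigma2_e_le with A1. }
  { apply sigma2_e_le with B1; auto. apply e_op_e_le. }
  (* Here [t] is [⟨e, ⟨j, ⟨⟨x, l⟩, b⟩⟩⟩]: the universal quantifiers over [x] and [l] are merged. *)
  destruct (univ_spec (fun t => W ⟨⟨⟨π1 t, π1 (π1 (π2 (π2 t)))⟩, ⟨π1 (π2 t), π1 (π1 (π2 (π2 t)))⟩⟩,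
                                   ⟨π2 (π1 (π2 (π2 t))), π2 (π2 (π2 t))⟩⟩)) as [i Hi]; [s1_tac |].
  specialize (EZ i).
  assert (P : (exists k, forall l, exists b, ~ univ ⟨i, ⟨i, ⟨k, ⟨l, b⟩⟩⟩⟩) <->
              exists j, forall x, Z ⟨i, x⟩ <-> e_op j B1 x).
  { assert (Q : forall j, (forall x, Z ⟨i, x⟩ <-> e_op j B1 x) <->
                          forall l, exists b, ~ univ ⟨i, ⟨i, ⟨j, ⟨l, b⟩⟩⟩⟩).
    { intro j. split.
      - intros H l. specialize (EW ⟨⟨i, π1 l⟩, ⟨j, π1 l⟩⟩). simp_pair.
        destruct (proj1 EW (H (π1 l)) (π2 l)) as [b Hb]. exists b. rewrite <- Hi. now simp_pair.
      - intros H x. specialize (EW ⟨⟨i, x⟩, ⟨j, x⟩⟩). simp_pair. apply EW.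
        intro l. destruct (H ⟨x, l⟩) as [b Hb]. exists b. rewrite <- Hi in Hb. now simp_pair. }
    split; intros [j Hj]; exists j; now apply Q. }
  assert (R : (exists k, forall l, exists b, ~ univ ⟨i, ⟨i, ⟨k, ⟨l, b⟩⟩⟩⟩) <->
    exists k, forall b, Y ⟨⟨i, π1 k⟩, ⟨π2 k, b⟩⟩).
  { assert (Q : forall k, (forall l, exists b, ~ univ ⟨i, ⟨i, ⟨k, ⟨l, b⟩⟩⟩⟩) <->
                          exists j, forall b, Y ⟨⟨i, k⟩, ⟨j, b⟩⟩).
    { intro k. rewrite <- EY. simp_pair. split.
      - intros H [l Hl]. destruct (H l) as [b Hb]. specialize (Hl b). simp_pair. auto.
      - intros H l. apply not_all_ex_not. intro N. apply H. exists l. intro b. simp_pair. apply N. }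
    split.
    - intros [k Hk]. apply Q in Hk. destruct Hk as [j Hj]. exists ⟨k, j⟩. now simp_pair.
    - intros [k Hk]. exists (π1 k). apply Q. eauto. }
  assert (N : (exists k, forall b, Y ⟨⟨i, π1 k⟩, ⟨π2 k, b⟩⟩) -> False).
  { intro N. apply EZ; [now apply P, R |].
    destruct N as [k Hk]. exists k. intro b. now simp_pair. }
  apply N, R, P, EZ. intros [k Hk]. apply N. exists k. intro b. specialize (Hk b). now simp_pair.
Qed.

(* Passing above a [Z] that avoids the first [C] in the list removes that [C] from consideration. *)
Lemma ahmad_of_list A (l : list nset) :
  (forall C, In C l -> ~ A ≤ₑ C) ->
  forall D, D ≤ₑ A -> ~ A ≤ₑ D ->
  (forall Z, D ≤ₑ Z -> Z ≤ₑ A -> A ≤ₑ Z \/ exists C, In C l /\ Z ≤ₑ C) ->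
  exists C D', In C l /\ ahmad A C D'.
Proof.
  induction l as [|C l IH]; intros HC D DA ND H.
  - exfalso. destruct (H D) as [|[C [[] _]]]; auto using e_le_refl.
  - destruct (classic (forall Z, D ≤ₑ Z -> Z ≤ₑ A -> A ≤ₑ Z \/ Z ≤ₑ C)) as [K|K].
    + exists C, D. split; [left; auto |]. split; [apply HC; left; auto |].
      split; [auto | split; [| auto]].
      destruct (K D); auto using e_le_refl. contradiction.
    + apply not_all_ex_not in K. destruct K as [Z0 K].
      apply imply_to_and in K. destruct K as [DZ K]. apply imply_to_and in K. destruct K as [ZA K].
      apply not_or_and in K. destruct K as [K1 K2].
      destruct IH with (D := Z0) as [C' [D' [I P]]]; auto.
      * intros C' I. apply HC. right; auto.
      * intros Z ZZ ZA'. destruct (H Z) as [|[C' [[<-|I] L]]]; auto.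
        -- now apply e_le_trans with Z0.
        -- exfalso. apply K2. now apply e_le_trans with Z.
        -- right. eauto.
      * exists C', D'. split; auto. right; auto.
Qed.

(** * Deduction of the three claims *)

Lemma Sigma02_e_le S A : S ≤ₑ A -> Sigma02 A -> Sigma02 S.
Proof. rewrite <- !sigma2_Sigma02. apply sigma2_e_le. Qed.

(** The claims ask for [Z] ahead of their hypotheses; if these fail, any Σ⁰₂ set serves. *)
Lemma exists_under_hypothesis (H : Prop) (P : nset -> Prop) :
  (exists Z, Sigma02 Z) -> (H -> exists Z, Sigma02 Z /\ P Z) -> exists Z, Sigma02 Z /\ (H -> P Z).
Proof.
  intros [Z0 S0] K. destruct (classic H) as [h|h].
  - destruct (K h) as [Z [SZ PZ]]. eauto.
  - exists Z0. tauto.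
Qed.

Theorem theorem7p1 :
  (forall A0 B0 A1 B1 : nset,
     Sigma02 A0 -> Sigma02 B0 -> Sigma02 A1 -> Sigma02 B1 ->
     exists Z : nset, Sigma02 Z /\
       (B0 ≤ₑ A1 /\ ~ A0 ≤ₑ B0 /\ ~ A1 ≤ₑ B1 ->
        (Z <ₑ A0 /\ ~ Z ≤ₑ B0) \/ (Z <ₑ A1 /\ ~ Z ≤ₑ B1)))
  /\
  (forall (n m : nat) (Ahat A : nset) (B C : nat -> nset),
     Sigma02 Ahat -> Sigma02 A ->
     (forall i, i <= n -> Sigma02 (B i)) ->
     (forall i, i <= m -> Sigma02 (C i)) ->
     exists Z : nset, Sigma02 Z /\
       (Ahat ≤ₑ A /\ Ahat ≤ₑ B 0 /\
        (forall i, i <= n -> i <> 0 -> ~ Ahat ≤ₑ B i) /\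
        pairwise_incomparable (A :: upto B n ++ upto C m) ->
        (Z <ₑ A /\ forall i, i <= n -> ~ Z ≤ₑ B i) \/
        (Z <ₑ B 0 /\ forall i, i <= m -> ~ Z ≤ₑ C i)))
  /\
  (forall A B C D0 D1 : nset,
     Sigma02 A -> Sigma02 B -> Sigma02 C -> Sigma02 D0 -> Sigma02 D1 ->
     exists Z : nset, Sigma02 Z /\
       (pairwise_incomparable [A; B; C] /\
        D0 <ₑ A /\ D0 <ₑ B /\ D1 <ₑ B /\ D1 <ₑ C ->
        (D0 <ₑ Z /\ Z <ₑ A /\ ~ Z ≤ₑ B) \/
        (D1 <ₑ Z /\ Z <ₑ B /\ ~ Z ≤ₑ C))).
Proof.
  split; [| split].
  - intros A0 B0 A1 B1 SA0 SB0 SA1 SB1. apply exists_under_hypothesis; [eauto |].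
    intros [L [N0 N1]]. apply NNPP. intro N.
    assert (K : forall Z, Z ≤ₑ A0 -> A0 ≤ₑ Z \/ Z ≤ₑ B0).
    { intros Z ZA. apply NNPP. intro K. apply N. exists Z. split; [now apply Sigma02_e_le with A0 |].
      left. unfold e_lt. tauto. }
    assert (K' : forall Z, Z ≤ₑ A1 -> A1 ≤ₑ Z \/ Z ≤ₑ B1).
    { intros Z ZA. apply NNPP. intro K'. apply N. exists Z. split; [now apply Sigma02_e_le with A1 |].
      right. unfold e_lt. tauto. }
    rewrite <- sigma2_Sigma02 in *.
    (* The base of both pairs is the empty set, which lies below every set. *)
    apply (no_ahmad_chain A0 B0 (fun _ => False) A1 B1 (fun _ => False)); auto;
      (split; [| split; [| split]]); auto using e_le_empty.
  - intros n m Ahat A B C SAh SA SB SC. apply exists_under_hypothesis; [eauto |].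
    intros [HA [HB [HN I]]]. apply NNPP. intro N.
    assert (Q : forall i, i <= m -> In (C i) (upto C m)).
    { intros i Hi. apply in_map, in_seq. lia. }
    assert (IB : ~ A ≤ₑ B 0).
    { inversion I as [|? ? F _]. subst. rewrite Forall_forall in F.
      apply (F (B 0)). now left. }
    assert (IC : forall i, i <= m -> ~ B 0 ≤ₑ C i).
    { intros i Hi. inversion I as [|? ? _ F]. subst. unfold upto in F at 1. cbn [seq map app] in F.
      inversion F as [|? ? F' _]. subst. rewrite Forall_forall in F'.
      apply (F' (C i)). apply in_or_app. auto. }
    assert (K : forall Z, Z ≤ₑ A -> A ≤ₑ Z \/ exists i, i <= n /\ Z ≤ₑ B i).
    { intros Z ZA. apply NNPP. intro K. apply N. exists Z. split; [now apply Sigma02_e_le with A |].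
      left. split; [unfold e_lt; tauto |]. intros i Hi L. apply K. eauto. }
    assert (K' : forall Z, Z ≤ₑ B 0 -> B 0 ≤ₑ Z \/ exists i, i <= m /\ Z ≤ₑ C i).
    { intros Z ZA. apply NNPP. intro K'. apply N. exists Z.
      split; [apply Sigma02_e_le with (B 0); auto with arith |].
      right. split; [unfold e_lt; tauto |]. intros i Hi L. apply K'. eauto. }
    (* Above [Ahat] only [B 0] can bound [Z]: any other [B i] above [Z] would be above [Ahat]. *)
    assert (H0 : ahmad A (B 0) Ahat).
    { split; [| split; [| split]]; auto. intros Z AZ ZA.
      destruct (K Z ZA) as [|[i [Hi L]]]; auto.
      destruct (Nat.eq_dec i 0) as [->|Ni]; auto.
      exfalso. apply (HN i Hi Ni). now apply e_le_trans with Z. }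
    (* Some [C i] forms a pair with [B 0] above a suitable base [D], so [B 0] is both the right half
       of one pair and the left half of another. *)
    destruct (ahmad_of_list (B 0) (upto C m)) with (D := fun _ : nat => False) as [C' [D [IC' P]]].
    + intros C' H. apply in_map_iff in H. destruct H as [i [<- Hi]]. apply in_seq in Hi.
      apply IC. lia.
    + apply e_le_empty.
    + intro L. apply (IC 0); [lia |]. apply e_le_trans with (fun _ => False); auto using e_le_empty.
    + intros Z _ ZB. destruct (K' Z ZB) as [|[i [Hi L]]]; eauto.
    + apply in_map_iff in IC'. destruct IC' as [i [<- Hi]]. apply in_seq in Hi.
      apply (no_ahmad_chain A (B 0) Ahat (B 0) (C i) D); auto using e_le_refl;
        apply sigma2_Sigma02; auto with arith. apply SC. lia.
  - intros A B C D0 D1 SA SB SC SD0 SD1. apply exists_under_hypothesis; [eauto |].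
    intros [I [[HA _] [[HB _] [[HB' _] [HC _]]]]]. apply NNPP. intro N.
    inversion I as [|? ? FA I']. subst. inversion I' as [|? ? FB _]. subst.
    inversion FA as [|? ? [IAB _] _]. subst. inversion FB as [|? ? [IBC _] _]. subst.
    (* Strictness above [D] is automatic: [Z ≤ₑ D] would give [Z ≤ₑ Y]. *)
    assert (K : forall X Y D Z, D ≤ₑ Y -> D ≤ₑ Z -> Z ≤ₑ X ->
      (D <ₑ Z /\ Z <ₑ X /\ ~ Z ≤ₑ Y) \/ X ≤ₑ Z \/ Z ≤ₑ Y).
    { intros X Y D Z DY DZ ZX. apply NNPP. intro K. apply not_or_and in K. destruct K as [K1 K2].
      apply not_or_and in K2. destruct K2 as [K2 K3]. apply K1. unfold e_lt. repeat split; auto.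
      intro L. apply K3. now apply e_le_trans with D. }
    apply (no_ahmad_chain A B D0 B C D1); auto using e_le_refl; try now apply sigma2_Sigma02.
    + split; [| split; [| split]]; auto. intros Z DZ ZA.
      destruct (K A B D0 Z) as [G|]; auto. exfalso. apply N. exists Z.
      split; [now apply Sigma02_e_le with A | auto].
    + split; [| split; [| split]]; auto. intros Z DZ ZB.
      destruct (K B C D1 Z) as [G|]; auto. exfalso. apply N. exists Z.
      split; [now apply Sigma02_e_le with B | auto].
Qed.
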